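(* Let $p$ be an odd prime, $m=p^2$ and $d=\frac{p+1}{2}$. For $1\le i\le p-1$ let $\beta_i$ be the tuple obtained by arranging in increasing order the $p+1$ numbers $i,\ i+p,\ i+2p,\ \dots,\ i+(p-1)p,\ p(p-i)$. Then the indecomposable tuples in $\mathfrak B_m^d$ are exactly the $p-1$ tuples $\beta_1,\dots,\beta_{p-1}$. Furthermore, for every integer $d'$ with $1\le d'\le \frac{m-1}{2}$ and $d'\neq \frac{p+1}{2}$, there are no indecomposable tuples in $\mathfrak B_m^{d'}$.
   Context: For an odd positive integer $m$ and an integer $1\le d\le \frac{m-1}{2}$, $\mathfrak B_m^d$ is the set of tuples $\beta=(b_1,\dots,b_{2d})$ of integers such that (1) $1\le b_1<b_2<\cdots<b_{2d}\le m-1$; (2) $\sum_{i=1}^{2d} b_i\equiv 0\pmod m$; (3) $|t\cdot\beta|=d$ for all $t\in(\mathbb{Z}/m\mathbb{Z})^\times$, where $|t\cdot\beta|=\sum_{i=1}^{2d}\langle tb_i\rangle_m/m$ and $\langle x\rangle_m$ denotes the representative of $x$ modulo $m$ in $\{0,\dots,m-1\}$. A tuple $\beta\in\mathfrak B_m^d$ is exceptional if its entries cannot be partitioned into pairs $b_i,b_j$ with $b_i+b_j\equiv 0\pmod m$. A tuple $\beta\in \mathfrak B_m^d$ is indecomposable if it is exceptional and no nonempty proper subset of $\{b_1,\dots,b_{2d}\}$ with an even number of elements has sum divisible by $m$. *)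

(* Defs.v *)
From mathcomp Require Import all_boot all_order all_algebra.

Set Implicit Arguments.
Unset Strict Implicit.
Unset Printing Implicit Defensive.

Import GRing.Theory.

(* |t . b|; the coercion of (t * x) : 'Z_m to nat is its representative in
   {0, ..., m - 1} (for m > 1, as 'Z_m is Z/2Z when m <= 1). *)
Definition weight (m : nat) (t : 'Z_m) (b : seq nat) : rat :=
  (\sum_(x <- b) (nat_of_ord (t * x%:R))%:R / m%:R)%R.

Definition inB (m d : nat) (b : seq nat) : Prop :=
  [/\ size b = 2 * d,
      all (fun x => 1 <= x <= m - 1) b /\ sorted ltn b,
      \sum_(x <- b) x = 0 %[mod m]
    & forall t : 'Z_m, (t \is a GRing.unit)%R -> weight t b = d%:R%R].

Definition exceptional (m : nat) (b : seq nat) : Prop :=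
  ~ exists2 q : seq (nat * nat),
      perm_eq (flatten [seq [:: z.1; z.2] | z <- q]) b
    & forall z, z \in q -> z.1 + z.2 = 0 %[mod m].

(* The entries of b are strictly increasing, so the subsets of
   {b_1, ..., b_2d} are exactly the subsequences of b. *)
Definition indecomposable (m d : nat) (b : seq nat) : Prop :=
  [/\ inB m d b,
      exceptional m b
    & forall s : seq nat, subseq s b -> s <> [::] -> s <> b ->
        ~~ odd (size s) -> ~~ (m %| \sum_(x <- s) x)].

Definition beta (p i : nat) : seq nat :=
  sort leq (rcons [seq i + j * p | j <- iota 0 p] (p * (p - i))).

(* Main.v *)
Require Import Defs.
From mathcomp Require Import all_boot all_order all_algebra finfield.
From mathcomp Require Import ring lra zify.
From mathcomp Require Import mathcomp_extra boolp classical_sets functions.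
From mathcomp Require Import reals Rstruct interval_inference topology.
From mathcomp Require Import normedtype sequences derive realfun exp trigo.

(* Let m = p^2 and let a be the indicator function of b on Z/m.  Condition (3)
   says that sum_x a(x) s(t x) = 0 for all units t, where s is the sawtooth
   function.  By the Fourier series of s this reads sum_n A(t n) / n = 0, where
   A is the sine transform of a.  Separating the n prime to p from the multiples
   of p gives odd functions f supported on the units with
   sum_n f(t n) / n = 0 for all units t, and these vanish: this is the statement
   L(1, chi) <> 0 for odd characters chi.  Inverting the sine transform,
   alpha(v) = a(v) - a(-v) depends only on v mod p when v is a unit, and
   alpha(p v) is a negative multiple of alpha(v).  If b is exceptional then
   alpha(v) > 0 for some unit v, hence b contains beta_i with i = v mod p; the
   sum of beta_i is divisible by m, so b = beta_i when b is indecomposable.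

   The vanishing of f is Mertens' argument written with real functions instead
   of characters.  Let K be the space of all such f, without the parity
   condition, and e its reproducing kernel at 1.  With Lambda the von Mangoldt
   function, sum_(n <= N) f(n) Lambda(n) / n is - f(1) ln N + O(1) for f in K
   and O(1) for f of the form t |-> sum_k g(t k) / k.  As Lambda >= 0 this gives
   e(1) <= 1 / phi(m).  By Cauchy-Schwarz every f in K then has constant absolute
   value on the units, so it is a multiple of a real character; for odd
   characters modulo p^2 this case is excluded by a parity argument. *)

Set Implicit Arguments.
Unset Strict Implicit.
Unset Printing Implicit Defensive.

Import Order.TTheory GRing.Theory Num.Theory.
Import numFieldNormedType.Exports.
Local Open Scope classical_set_scope.
Local Open Scope ring_scope.

(** * Moebius and von Mangoldt functions *)

Lemma sum_divisors (V : nmodType) (F : nat -> V) (n N : nat) :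
  (0 < n <= N)%N ->
  \sum_(d <- divisors n) F d = \sum_(1 <= d < N.+1 | (d %| n)%N) F d.
Proof.
move=> /andP[n0 nN]; rewrite -[RHS]big_filter; apply: perm_big.
apply: uniq_perm; rewrite ?filter_uniq ?iota_uniq ?divisors_uniq// => d.
rewrite mem_filter mem_index_iota -dvdn_divisors// andbC.
case dn: (d %| n)%N => //; rewrite ?andbF// andbT.
by rewrite (dvdn_gt0 n0 dn) ltnS (leq_trans (dvdn_leq n0 dn) nN).
Qed.

Lemma sum_multiples (V : nmodType) (F : nat -> V) (e N : nat) : (0 < e)%N ->
  \sum_(1 <= n < N.+1 | (e %| n)%N) F n =
  \sum_(1 <= k < (N %/ e).+1) F (e * k)%N.
Proof.
move=> e0; rewrite -big_filter -(big_map (muln e) xpredT F); apply: perm_big.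
apply: uniq_perm; rewrite ?filter_uniq ?iota_uniq//.
  by rewrite map_inj_uniq ?iota_uniq// => x y /eqP; rewrite eqn_pmul2l// => /eqP.
move=> n; rewrite mem_filter mem_index_iota; apply/idP/mapP.
  move=> /and3P[/dvdnP[k ->] k0 kN]; exists k; last by rewrite mulnC.
  rewrite mem_index_iota ltnS leq_divRL//; apply/andP; split; last by lia.
  by case: k k0 {kN}.
move=> [k]; rewrite mem_index_iota ltnS leq_divRL// => /andP[k0 kN] ->.
by rewrite dvdn_mulr// muln_gt0 e0 k0 ltnS mulnC.
Qed.

Lemma sum_divisors_exchange (V : nmodType) (G : nat -> nat -> V) (N : nat) :
  \sum_(1 <= n < N.+1) \sum_(d <- divisors n) G d (n %/ d)%N =
  \sum_(1 <= d < N.+1) \sum_(1 <= k < (N %/ d).+1) G d k.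
Proof.
rewrite (eq_big_nat _ _
  (F2 := fun n => \sum_(1 <= d < N.+1 | (d %| n)%N) G d (n %/ d)%N)); last first.
  by move=> n nN; rewrite (@sum_divisors _ (fun d => G d (n %/ d)%N) n N).
rewrite (exchange_big_dep_nat xpredT)//=; apply: eq_big_nat => d /andP[d0 _].
rewrite (sum_multiples (fun n => G d (n %/ d)%N))//.
by apply: eq_bigr => k _; rewrite mulKn.
Qed.

(** Associativity of Dirichlet convolution: with [f = d %/ e], both sides run over the pairs with
    [e * f %| n]. *)
Lemma sum_divisors2 (V : nmodType) (G : nat -> nat -> V) (n : nat) : (0 < n)%N ->
  \sum_(d <- divisors n) \sum_(e <- divisors d) G e (d %/ e)%N =
  \sum_(f <- divisors n) \sum_(e <- divisors (n %/ f)%N) G e f.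
Proof.
move=> n0.
transitivity (\sum_(1 <= e < n.+1) \sum_(1 <= f < n.+1 | (e * f %| n)%N) G e f).
  rewrite (@sum_divisors _ _ n n) ?n0 ?leqnn//= big_nat_cond.
  rewrite (eq_bigr
    (fun d => \sum_(1 <= e < n.+1 | (e %| d)%N) G e (d %/ e)%N)); last first.
    move=> d /andP[/andP[d0 dn] _].
    by rewrite (@sum_divisors _ (fun e => G e (d %/ e)%N) d n)// d0.
  rewrite -big_nat_cond (exchange_big_dep_nat xpredT)//=.
  apply: eq_big_nat => e /andP[e0 en].
  under eq_bigl => d do rewrite andbC.
  rewrite big_mkcondr (sum_multiples (fun d => if (d %| n)%N then _ else _))//=.
  rewrite -[LHS]big_mkcond [RHS](@big_cat_nat _ _ _ (n %/ e).+1)//=; last first.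
    by rewrite ltnS leq_div.
  rewrite [X in _ = _ + X]big_nat_cond [X in _ = _ + X]big1 ?addr0.
    by apply: eq_bigr => k _; rewrite mulKn.
  move=> k /andP[/andP[+ _] /dvdn_leq - /(_ n0)]; rewrite ltn_divLR//; lia.
rewrite (exchange_big_dep_nat xpredT)//= (@sum_divisors _ _ n n) ?n0 ?leqnn//.
rewrite [LHS](bigID (fun f => f %| n)%N)/= [X in _ + X]big1 ?addr0; last first.
  move=> f /negP fn; apply: big1 => e efn; case: fn.
  by apply: dvdn_trans efn; rewrite dvdn_mull.
rewrite big_nat_cond [RHS]big_nat_cond.
apply: eq_bigr => f /andP[/andP[f0 fn] fdn].
rewrite (@sum_divisors _ _ (n %/ f)%N n); last first.
  by rewrite divn_gt0// leq_div// andbT.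
by apply: eq_bigl => e; rewrite dvdn_divRL//.
Qed.

Definition mobius (R : comNzRingType) (n : nat) : R :=
  \prod_(q <- primes n) (if logn q n == 1%N then -1 else 0).

Lemma mobius_norm (R : realDomainType) (n : nat) : `|mobius R n| <= 1.
Proof.
rewrite /mobius normr_prod; apply: prodr_ile1 => // i _; rewrite normr_ge0/=.
by case: ifP; rewrite ?normrN1 ?normr0.
Qed.

Lemma mobius_mul_prime (R : comNzRingType) (q n : nat) :
  prime q -> (0 < n)%N -> ~~ (q %| n)%N -> mobius R (q * n) = - mobius R n.
Proof.
move=> qP n0 qn; rewrite /mobius.
have perm : perm_eq (primes (q * n)) (q :: primes n).
  apply: uniq_perm; rewrite ?primes_uniq//=.
    by rewrite primes_uniq mem_primes (negbTE qn) !andbF.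
  by move=> r; rewrite (primesM _ (prime_gt0 qP) n0) primes_prime// !inE.
rewrite (perm_big _ perm) big_cons/=
  (lognM _ (prime_gt0 qP) n0) logn_prime// eqxx.
rewrite (eqP (_ : logn q n == 0%N)); last by rewrite lognE qP n0 (negbTE qn).
rewrite addn0 eqxx mulN1r; congr (- _); apply: eq_big_seq => r.
rewrite mem_primes => /and3P[rP _ rn].
rewrite (lognM _ (prime_gt0 qP) n0) logn_prime//.
by case: (eqVneq r q) => // rq; move: qn; rewrite -rq rn.
Qed.

Lemma mobius_square (R : comNzRingType) (q n : nat) :
  prime q -> (0 < n)%N -> (q ^ 2 %| n)%N -> mobius R n = 0.
Proof.
move=> qP n0; rewrite pfactor_dvdn// => q2.
have qn : q \in primes n by rewrite -logn_gt0; apply: leq_trans q2.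
rewrite /mobius (perm_big _ (perm_to_rem qn)) big_cons/=.
by case: eqP q2 => [->//|_ _]; rewrite mul0r.
Qed.

(* Terms with [q ^ 2 %| d] vanish; the others are grouped as [e, q * e]. *)
Lemma sum_mobius_pair (R : comNzRingType) (F : nat -> R) (q n : nat) :
  prime q -> (0 < n)%N -> (q %| n)%N ->
  \sum_(d <- divisors n) mobius R d * F d =
  \sum_(e <- divisors n`_(q^')%N) mobius R e * (F e - F (q * e)%N).
Proof.
move=> qP n0 qn; have n'0 : (0 < n`_(q^'))%N by rewrite part_gt0.
have nE : n = (n`_q * n`_(q^'))%N by rewrite partnC.
have q'n : ~~ (q %| n`_(q^'))%N.
  apply/negP => h; have := part_pnat (q^')%N n.
  by move=> /pnatP -/(_ n'0 q qP h); rewrite !inE eqxx.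
have qe e : (e %| n`_(q^'))%N -> ~~ (q %| e)%N.
  by move=> en; apply: contra q'n => h; exact: dvdn_trans en.
rewrite (bigID (fun d => q %| d)%N)/= addrC.
transitivity (\sum_(e <- divisors n`_(q^')%N) mobius R e * F e +
    \sum_(e <- divisors n`_(q^')%N) mobius R (q * e) * F (q * e)%N); last first.
  rewrite -big_split/=; apply: eq_big_seq => e; rewrite -dvdn_divisors// => en.
  by rewrite mobius_mul_prime ?(dvdn_gt0 n'0 en) ?qe// mulrBr mulNr.
congr (_ + _).
  rewrite -big_filter; apply: perm_big.
  apply: uniq_perm; rewrite ?filter_uniq ?divisors_uniq// => d.
  rewrite mem_filter -!dvdn_divisors//; apply/andP/idP => [[qd dn]|dn].
    rewrite nE Gauss_dvdr// in dn; rewrite p_part coprimeXr//.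
    by rewrite coprime_sym prime_coprime.
  by split; [exact: qe|rewrite nE dvdn_mull].
rewrite (bigID (fun d => q ^ 2 %| d)%N)/= big_seq_cond big1 ?add0r; last first.
  move=> d /andP[+ /andP[_ q2]]; rewrite -dvdn_divisors// => dn.
  by rewrite (@mobius_square _ q)// ?mul0r// (dvdn_gt0 n0 dn).
rewrite -big_filter -[RHS](big_map (muln q) xpredT (fun d => mobius R d * F d)).
apply: perm_big; apply: uniq_perm; rewrite ?filter_uniq ?divisors_uniq//.
  rewrite map_inj_uniq ?divisors_uniq// => x y /eqP.
  by rewrite eqn_pmul2l ?prime_gt0// => /eqP.
move=> d; rewrite mem_filter -dvdn_divisors//; apply/idP/mapP.
  move=> /andP[/andP[/dvdnP[e ->]] q2 dn]; exists e; last by rewrite mulnC.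
  rewrite -dvdn_divisors//.
  have qe' : ~~ (q %| e)%N.
    by apply: contra q2 => h; rewrite expnS expn1 dvdn_pmul2r ?prime_gt0.
  have : (e %| n)%N by apply: dvdn_trans dn; rewrite dvdn_mulr.
  rewrite {1}nE Gauss_dvdr// p_part coprimeXr//.
  by rewrite coprime_sym prime_coprime.
move=> [e]; rewrite -dvdn_divisors// => en ->; rewrite dvdn_mulr//=.
rewrite expnS expn1 dvdn_pmul2l ?prime_gt0// qe//=.
rewrite nE dvdn_mul// p_part -{1}[q]expn1 dvdn_exp2l//.
by rewrite logn_gt0 mem_primes qP n0.
Qed.

(** In [sum_mobius_pair] with a constant [F], every difference vanishes. *)
Lemma sum_mobius (R : comNzRingType) (n : nat) : (0 < n)%N ->
  \sum_(d <- divisors n) mobius R d = (n == 1%N)%:R.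
Proof.
move=> n0; case: eqP => [->|/eqP n1]; first by rewrite big_seq1 /mobius big_nil.
under eq_bigr do rewrite -[mobius _ _]mulr1.
have n2 : (1 < n)%N by case: n n0 n1 => [|[]].
rewrite (@sum_mobius_pair _ (fun=> 1) (pdiv n)) ?pdiv_prime ?pdiv_dvd//.
by rewrite big1// => e _; rewrite subrr mulr0.
Qed.

(** This form avoids a case distinction on prime powers; the usual characterization is
    [sum_vonMangoldt]. *)
Definition vonMangoldt (R : realType) (n : nat) : R :=
  - \sum_(d <- divisors n) mobius R d * ln d%:R.

(** Pairing [e] with [q * e] for a prime [q] dividing [n] gives [ln q] times the sum of the Moebius
    function over the divisors of the prime-to-[q] part of [n], which is 0 or 1. *)
Lemma vonMangoldt_ge0 (R : realType) (n : nat) :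
  (0 < n)%N -> 0 <= vonMangoldt R n.
Proof.
move=> n0; case: (eqVneq n 1%N) => [->|n1].
  by rewrite /vonMangoldt big_seq1 ln1 mulr0 oppr0.
have n2 : (1 < n)%N by case: n n0 n1 => [|[]].
have qP := pdiv_prime n2; set q := pdiv n in qP.
rewrite /vonMangoldt (@sum_mobius_pair _ (fun d => ln d%:R) q) ?pdiv_dvd//.
rewrite (eq_big_seq (fun e => - ln q%:R * mobius R e)); last first.
  move=> e; rewrite -dvdn_divisors ?part_gt0// => en.
  have e0 : (0 < e)%N by rewrite (dvdn_gt0 _ en) ?part_gt0.
  rewrite natrM lnM ?posrE ?ltr0n ?(prime_gt0 qP)//; ring.
rewrite -mulr_sumr sum_mobius ?part_gt0// mulNr opprK mulr_ge0//.
by rewrite ln_ge0// ler1n prime_gt0.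
Qed.

Lemma vonMangoldt_ln_quotient (R : realType) (n : nat) : (0 < n)%N ->
  vonMangoldt R n = \sum_(d <- divisors n) mobius R d * ln (n %/ d)%:R.
Proof.
move=> n0; apply/eqP; rewrite eq_sym -subr_eq0 opprK -big_split/=; apply/eqP.
rewrite (eq_big_seq (fun d => ln n%:R * mobius R d)).
  rewrite -mulr_sumr sum_mobius//; case: eqP => [->|_]; last by rewrite mulr0.
  by rewrite ln1 mul0r.
move=> d; rewrite -dvdn_divisors// => /dvdnP[k nE].
have d0 : (0 < d)%N by move: n0; rewrite nE muln_gt0 => /andP[].
have k0 : (0 < k)%N by move: n0; rewrite nE muln_gt0 => /andP[].
rewrite nE mulnK// natrM lnM ?posrE ?ltr0n//; ring.
Qed.

(** Moebius inversion: after regrouping by [f], the inner Moebius sum leaves only [f = n]. *)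
Lemma sum_vonMangoldt (R : realType) (n : nat) : (0 < n)%N ->
  \sum_(d <- divisors n) vonMangoldt R d = ln n%:R.
Proof.
move=> n0; rewrite (eq_big_seq (fun d =>
    \sum_(e <- divisors d) mobius R e * ln (d %/ e)%:R)); last first.
  move=> d; rewrite -dvdn_divisors// => dn.
  by rewrite vonMangoldt_ln_quotient// (dvdn_gt0 n0 dn).
rewrite (@sum_divisors2 _ (fun e f => mobius R e * ln f%:R))//.
rewrite (eq_big_seq (fun f => (n == f)%:R * ln f%:R)).
  rewrite (bigD1_seq n) ?divisors_uniq -?dvdn_divisors//= eqxx mul1r.
  by rewrite big1 ?addr0// => f /negbTE nf; rewrite eq_sym nf mul0r.
move=> f; rewrite -dvdn_divisors// => /dvdnP[k nE].
have f0 : (0 < f)%N by move: n0; rewrite nE muln_gt0 => /andP[].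
have k0 : (0 < k)%N by move: n0; rewrite nE muln_gt0 => /andP[].
rewrite -mulr_suml nE mulnK// sum_mobius//; congr (_%:R * _).
by rewrite -{2}[f]mul1n eqn_pmul2r.
Qed.

Lemma sum_vonMangoldt_exchange (R : realType) (g : nat -> R) (N : nat) :
  \sum_(1 <= n < N.+1) g n * ln n%:R =
  \sum_(1 <= d < N.+1) vonMangoldt R d * \sum_(1 <= k < (N %/ d).+1) g (d * k)%N.
Proof.
transitivity (\sum_(1 <= n < N.+1) \sum_(d <- divisors n)
   vonMangoldt R d * g (d * (n %/ d))%N).
  apply: eq_big_nat => n /andP[n0 _]; rewrite -sum_vonMangoldt// mulr_sumr.
  by apply: eq_big_seq => d;
    rewrite -dvdn_divisors// mulrC => /divnK; rewrite mulnC => ->.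
rewrite (sum_divisors_exchange (fun d k => vonMangoldt R d * g (d * k)%N)).
by apply: eq_bigr => d _; rewrite mulr_sumr.
Qed.

(** Summed over [d %| n], the weights [mobius d * (ln N - ln d)] give [ln N] at [n = 1] plus
    [vonMangoldt n]. When the inner sums on the right are small, this yields the term of order
    [ln N] in Mertens' argument. *)
Lemma sum_mobius_exchange (R : realType) (g : nat -> R) (N : nat) : (0 < N)%N ->
  g 1%N * ln N%:R + \sum_(1 <= n < N.+1) g n * vonMangoldt R n =
  \sum_(1 <= d < N.+1) mobius R d * (ln N%:R - ln d%:R) *
    \sum_(1 <= k < (N %/ d).+1) g (d * k)%N.
Proof.
move=> N0.
transitivity (\sum_(1 <= n < N.+1) \sum_(d <- divisors n)
   mobius R d * (ln N%:R - ln d%:R) * g (d * (n %/ d))%N); last first.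
  rewrite (sum_divisors_exchange
    (fun d k => mobius R d * (ln N%:R - ln d%:R) * g (d * k)%N)).
  by apply: eq_bigr => d _; rewrite mulr_sumr.
transitivity (\sum_(1 <= n < N.+1)
   g n * ((n == 1%N)%:R * ln N%:R + vonMangoldt R n)).
  under [RHS]eq_bigr do rewrite mulrDr.
  rewrite big_split/=; congr (_ + _).
  rewrite big_ltn ?ltnS// eqxx mul1r big_nat_cond big1 ?addr0//.
  by move=> i /andP[/andP[i1 _] _]; rewrite gtn_eqF// mul0r mulr0.
apply: eq_big_nat => n /andP[n0 _].
rewrite -(sum_mobius R n0) /vonMangoldt mulr_suml -sumrB mulr_sumr.
apply: eq_big_seq => d; rewrite -dvdn_divisors// mulnC => /divnK ->; ring.
Qed.

(** * Chebyshev and Mertens bounds *)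

Lemma ln_succ_le (R : realType) (n : nat) : (0 < n)%N ->
  ln n.+1%:R <= ln n%:R + n%:R^-1 :> R.
Proof.
move=> n0; have n0R : 0 < n%:R :> R by rewrite ltr0n.
have -> : n.+1%:R = n%:R * (1 + n%:R^-1) :> R.
  by rewrite mulrDr mulfV ?gt_eqF// mulr1 -natr1.
have v0 : 0 < n%:R^-1 :> R by rewrite invr_gt0.
rewrite lnM ?posrE ?addr_gt0// lerD2l le_ln1Dx//; lra.
Qed.

Lemma sum_ln_le (R : realType) (N : nat) :
  \sum_(1 <= n < N.+1) ln n%:R <= N%:R * ln N%:R :> R.
Proof.
apply: (@le_trans _ _ (\sum_(1 <= n < N.+1) (ln N%:R : R))).
  apply: ler_sum_nat => n /andP[n0 nN].
  by rewrite ler_ln ?posrE ?ltr0n ?ler_nat//; lia.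
by rewrite sumr_const_nat subn1/= mulr_natl.
Qed.

(** Going from [N] to [N + 1], the function [x ln x] grows by at most [ln (N + 1) + 1], by
    [ln_succ_le]. *)
Lemma sum_ln_ge (R : realType) (N : nat) :
  N%:R * ln N%:R - N%:R <= \sum_(1 <= n < N.+1) ln n%:R :> R.
Proof.
elim: N => [|N IH]; first by rewrite big_nil mul0r subr0.
rewrite big_nat_recr//=; case: N IH => [|N] IH.
  by rewrite big_nil ln1 mulr0; lra.
have := @ln_succ_le R N.+1 isT; move: IH.
set S := \sum_(_ <= _ < _) _; rewrite -[N.+2%:R in X in _ -> _ -> X]natr1.
rewrite -[N.+2%:R]natr1; set x := N.+1%:R; have x0 : 0 < x by rewrite ltr0n.
move=> IH /(ler_wpM2l (ltW x0)); rewrite mulrDr mulfV ?gt_eqF//.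
nra.
Qed.

Definition chebyshev_psi (R : realType) (N : nat) : R :=
  \sum_(1 <= n < N.+1) vonMangoldt R n.

Lemma sum_vonMangoldt_floor (R : realType) (N : nat) :
  \sum_(1 <= n < N.+1) ln n%:R =
  \sum_(1 <= d < N.+1) vonMangoldt R d * (N %/ d)%:R.
Proof.
transitivity (\sum_(1 <= n < N.+1) 1 * ln n%:R : R).
  by apply: eq_bigr => n _; rewrite mul1r.
rewrite (sum_vonMangoldt_exchange (fun=> 1)); apply: eq_bigr => d _.
by rewrite sumr_const_nat subn1.
Qed.

(** Chebyshev's argument with the central binomial coefficient: its logarithm is the sum of
    [vonMangoldt d * (2N %/ d - 2 (N %/ d))], where the factor is never negative and is at least 1
    for [N < d <= 2N]. The bounds on sums of logarithms give at most [2N ln 2 + 2N]. *)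
Lemma chebyshev_psi_double (R : realType) (N : nat) : (0 < N)%N ->
  chebyshev_psi R (2 * N) <= chebyshev_psi R N + 4 * N%:R.
Proof.
move=> N0; have N0R : 0 < N%:R :> R by rewrite ltr0n.
(* The range is extended to [2 * N], where [N %/ d = 0], so that the two sums can be compared
   termwise. *)
have h1 : \sum_(1 <= n < N.+1) ln n%:R =
    \sum_(1 <= d < (2 * N).+1) vonMangoldt R d * (N %/ d)%:R.
  rewrite sum_vonMangoldt_floor [RHS](@big_cat_nat _ _ _ N.+1)//=; last by lia.
  rewrite [X in _ = _ + X]big_nat_cond [X in _ = _ + X]big1 ?addr0// => d /andP[/andP[dN _] _].
  by rewrite divn_small// mulr0.
have := @sum_ln_le R (2 * N)%N; have := @sum_ln_ge R N.
rewrite h1 sum_vonMangoldt_floor natrM lnM ?posrE ?ltr0n//.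
have l2 : ln 2 <= 1 :> R.
  by have := @le_ln1Dx R 1; rewrite -[1 + 1]/(2%:R); apply; lra.
have : chebyshev_psi R (2 * N) - chebyshev_psi R N <=
    \sum_(1 <= d < (2 * N).+1) vonMangoldt R d * (2 * N %/ d)%:R -
    2 * \sum_(1 <= d < (2 * N).+1) vonMangoldt R d * (N %/ d)%:R.
  rewrite mulr_sumr -sumrB {1}/chebyshev_psi (@big_cat_nat _ _ _ N.+1)//=; last by lia.
  rewrite addrAC subrr add0r (@big_cat_nat _ _ _ N.+1 1 (2 * N).+1)//=; last by lia.
  rewrite -[leLHS]add0r; apply: lerD.
    rewrite big_nat_cond; apply: sumr_ge0 => d /andP[/andP[d0 _] _].
    rewrite mulrCA -mulrBr mulr_ge0 ?vonMangoldt_ge0// -natrM subr_ge0 ler_nat.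
    by rewrite leq_divRL// -mulnA leq_mul2l leq_divM.
  apply: ler_sum_nat => d /andP[Nd dN].
  have d0 : (0 < d)%N by lia.
  rewrite (divn_small Nd) !mulr0 subr0 ler_peMr ?vonMangoldt_ge0//.
  by rewrite ler1n divn_gt0.
set S1 := \sum_(_ <= _ < _) _ * (2 * N %/ _)%:R; set S2 := \sum_(_ <= _ < _) _.
nra.
Qed.

(** Powers of 2 suffice: the later asymptotic comparison only needs one sequence tending to
    infinity. *)
Lemma chebyshev_psi_pow2 (R : realType) (k : nat) :
  chebyshev_psi R (2 ^ k) <= 4 * (2 ^ k)%:R.
Proof.
elim: k => [|k IH].
  rewrite /chebyshev_psi expn0 big_nat1 /vonMangoldt big_seq1 ln1 mulr0; lra.
rewrite expnS; apply: le_trans (@chebyshev_psi_double R (2 ^ k) _) _.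
  by rewrite expn_gt0.
rewrite natrM; lra.
Qed.

(** Mertens' upper bound: [N / n <= N %/ n + 1], so [N] times the sum is at most [ln N!] plus
    [chebyshev_psi N]. *)
Lemma sum_vonMangoldt_div_pow2 (R : realType) (k : nat) :
  \sum_(1 <= n < (2 ^ k).+1) vonMangoldt R n / n%:R <= ln (2 ^ k)%:R + 4.
Proof.
set N := (2 ^ k)%N; have N0 : 0 < N%:R :> R by rewrite ltr0n expn_gt0.
rewrite -(ler_pM2l N0).
apply: (@le_trans _ _ (\sum_(1 <= n < N.+1) ln n%:R + chebyshev_psi R N)).
  rewrite sum_vonMangoldt_floor -big_split/= mulr_sumr.
  apply: ler_sum_nat => d /andP[d0 dN].
  have d0R : 0 < d%:R :> R by rewrite ltr0n.
  rewrite -{3}[vonMangoldt R d]mulr1 -mulrDr mulrCA.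
  apply: ler_wpM2l; rewrite ?vonMangoldt_ge0// ler_pdivrMr// natr1 -natrM ler_nat.
  by rewrite ltnW// ltn_ceil.
rewrite mulrDr lerD ?sum_ln_le// mulrC; exact: chebyshev_psi_pow2.
Qed.

Lemma abel_bound (R : realDomainType) (a u : nat -> R) (B : R) (n : nat) :
  (forall n, `|\sum_(i < n) a i| <= B) -> (forall i, u i.+1 <= u i) ->
  (forall i, 0 <= u i) -> `|\sum_(i < n) a i * u i| <= B * u 0%N.
Proof.
move=> aB u_dec u0.
(* Summation by parts, with the boundary term subtracted so that the induction closes. *)
have h k : `|\sum_(i < k) a i * u i - (\sum_(i < k) a i) * u k|
    <= B * (u 0%N - u k).
  elim: k => [|k IH]; first by rewrite !big_ord0 mul0r !subrr mulr0 normr0.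
  have -> : \sum_(i < k.+1) a i * u i - (\sum_(i < k.+1) a i) * u k.+1 =
     (\sum_(i < k) a i * u i - (\sum_(i < k) a i) * u k) +
     (\sum_(i < k.+1) a i) * (u k - u k.+1).
    by rewrite !big_ord_recr/=; ring.
  apply: le_trans (ler_normD _ _) _; rewrite normrM.
  have := ler_wpM2r (normr_ge0 (u k - u k.+1)) (aB k.+1).
  rewrite [`|u k - _|]ger0_norm ?subr_ge0//; lra.
have := h n; have := ler_wpM2r (u0 n) (aB n); rewrite -(ger0_norm (u0 n)) -normrM.
rewrite (ger0_norm (u0 n)).
set S := \sum_(i < n) _ * _; set T := _ * u n => h1 h2.
have := ler_normD (S - T) T; rewrite subrK; lra.
Qed.

(** * Harmonic sums of periodic functions *)

Lemma natr_modulus (m : nat) : (1 < m)%N -> m%:R = 0 :> 'Z_m.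
Proof. by move=> m1; rewrite -[LHS]Zp_nat_mod// modnn. Qed.

Lemma sum_Zp_period (V : nmodType) (m M : nat) (f : 'Z_m -> V) : (1 < m)%N ->
  \sum_(i < m) f (M + i)%:R = \sum_x f x.
Proof.
move=> m1; elim: M => [|M IH].
  have E (F : nat -> V) : \sum_(i < m) F i = \sum_(i < (Zp_trunc m).+2) F i.
    by rewrite Zp_cast.
  rewrite (E (fun i => f (0 + i)%:R)).
  by apply: eq_bigr => x _; rewrite add0n natr_Zp.
rewrite -{}IH; case: m m1 f => // m m1 f.
rewrite big_ord_recr [RHS]big_ord_recl/= addrC; congr (_ + _).
  by congr f; rewrite addSnnS addn0 natrD natr_modulus// addr0.
by apply: eq_bigr => i _; rewrite addSnnS.
Qed.

(** The partial sums [A] from 0 are periodic, hence bounded, and any block is a difference of two of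
    them. *)
Lemma sum_Zp_bounded (R : realDomainType) (m : nat) (f : 'Z_m -> R) :
  (1 < m)%N -> \sum_x f x = 0 ->
  exists B : R, forall M n, `|\sum_(i < n) f (M + i)%:R| <= B.
Proof.
move=> m1 f0; pose A n := \sum_(i < n) f i%:R.
have Am n k : A (n + k * m)%N = A n.
  elim: k => [|k IH]; first by rewrite addn0.
  by rewrite mulSnr addnA {1}/A big_split_ord/= sum_Zp_period// f0 addr0.
exists (2 * \sum_(j < m) `|A j|) => M n.
have AB k : `|A k| <= \sum_(j < m) `|A j|.
  rewrite {1}(divn_eq k m) addnC Am.
  have km : (k %% m < m)%N by rewrite ltn_mod; lia.
  by rewrite (bigD1 (Ordinal km))//= lerDl sumr_ge0.
have -> : \sum_(i < n) f (M + i)%:R = A (M + n)%N - A M.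
  by rewrite /A big_split_ord/= addrAC subrr add0r.
by apply: le_trans (ler_normB _ _) _; rewrite mulr_natl mulr2n lerD.
Qed.

Definition harmonic_sum (R : realType) (m : nat) (f : 'Z_m -> R) (N : nat) : R :=
  \sum_(1 <= k < N.+1) f k%:R / k%:R.

Lemma harmonic_sum_lin (R : realType) (m : nat) (I : finType) (a : I -> R)
    (f : I -> 'Z_m -> R) (N : nat) :
  harmonic_sum (fun x => \sum_i a i * f i x) N =
  \sum_i a i * harmonic_sum (f i) N.
Proof.
rewrite /harmonic_sum; under eq_bigr do rewrite mulr_suml.
rewrite exchange_big/=; apply: eq_bigr => i _; rewrite mulr_sumr.
by apply: eq_bigr => k _; rewrite mulrA.
Qed.

Lemma harmonic_sum_tail (R : realType) (m : nat) (f : 'Z_m -> R) :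
  (1 < m)%N -> \sum_x f x = 0 ->
  exists2 B : R, 0 <= B & forall N N', (N <= N')%N ->
    `|harmonic_sum f N' - harmonic_sum f N| <= B / N.+1%:R.
Proof.
move=> m1 /(sum_Zp_bounded m1)[B fB]; exists B.
  by apply: le_trans (fB 0%N 0%N).
move=> N N' NN'; rewrite {1}/harmonic_sum (@big_cat_nat _ _ _ N.+1)//= addrAC subrr add0r.
rewrite -{1}[N.+1]add0n big_addn subSS big_mkord.
under eq_bigr do rewrite addnC.
apply: le_trans (@abel_bound _ (fun i => f (N.+1 + i)%:R)
  (fun i => (N.+1 + i)%:R^-1) B _ _ _ _) _.
- by move=> n; exact: fB.
- by move=> i; rewrite lef_pV2 ?posrE ?ltr0n ?ler_nat//; lia.
- by move=> i; rewrite invr_ge0.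
- by rewrite addn0.
Qed.

(** Convergence is not part of the definition; it is provided by [cvg_harmonic] when [f] has sum
    0. *)
Definition harmonic_lim (R : realType) (m : nat) (f : 'Z_m -> R) : R :=
  lim (harmonic_sum f @ \oo).

Lemma cvg_harmonic (R : realType) (m : nat) (f : 'Z_m -> R) :
  (1 < m)%N -> \sum_x f x = 0 -> harmonic_sum f @ \oo --> harmonic_lim f.
Proof.
move=> m1 f0; have [B B0 fB] := harmonic_sum_tail m1 f0.
apply: cauchy_cvg; apply: cauchy_exP => e e0.
have [N NB] : exists N : nat, B / N.+1%:R < e.
  exists (Num.truncn (B / e)); rewrite ltr_pdivrMr ?ltr0n// mulrC -ltr_pdivrMr//.
  by rewrite truncnS_gt.
exists (harmonic_sum f N); exists N => // n /= Nn.
rewrite /ball/= distrC; apply: le_lt_trans (fB _ _ Nn) NB.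
Qed.

Lemma harmonic_lim_tail (R : realType) (m : nat) (f : 'Z_m -> R) :
  (1 < m)%N -> \sum_x f x = 0 ->
  exists2 B : R, 0 <= B & forall N,
    `|harmonic_lim f - harmonic_sum f N| <= B / N.+1%:R.
Proof.
move=> m1 f0; have [B B0 fB] := harmonic_sum_tail m1 f0; exists B => // N.
have h : `|harmonic_sum f N - harmonic_sum f n| @[n --> \oo] -->
    `|harmonic_sum f N - harmonic_lim f|.
  by apply: cvg_norm; apply: cvgB; [exact: cvg_cst|exact: cvg_harmonic].
rewrite distrC -(cvg_lim _ h)//.
apply: limr_le; first by apply/cvg_ex; eexists; exact: h.
by exists N => // n /= Nn; rewrite /= distrC fB.
Qed.

Lemma harmonic_limE (R : realType) (m : nat) (f : 'Z_m -> R) (l : R) :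
  harmonic_sum f @ \oo --> l -> harmonic_lim f = l.
Proof. by move=> fl; apply: cvg_lim. Qed.

Lemma harmonic_lim_lin (R : realType) (m : nat) (I : finType) (a : I -> R)
    (f : I -> 'Z_m -> R) :
  (1 < m)%N -> (forall i, \sum_x f i x = 0) ->
  harmonic_lim (fun x => \sum_i a i * f i x) = \sum_i a i * harmonic_lim (f i).
Proof.
move=> m1 f0; apply: harmonic_limE.
rewrite (_ : harmonic_sum _ = fun N => \sum_i a i * harmonic_sum (f i) N).
  2: by apply/funext => N; exact: harmonic_sum_lin.
apply: cvg_big => [|i _]; first exact: add_continuous.
by apply: cvgMr; exact: cvg_harmonic.
Qed.

Definition on_units (R : realType) (m : nat) (f : 'Z_m -> R) : Prop :=
  forall x, x \isn't a GRing.unit -> f x = 0.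

(** A unit [d] permutes the terms; for a nonunit [d] no [d * x] is a unit, so every term is 0. *)
Lemma sum_dilate (R : realType) (m : nat) (f : 'Z_m -> R) (d : 'Z_m) :
  on_units f -> \sum_x f x = 0 -> \sum_x f (d * x) = 0.
Proof.
move=> fu f0; have [ud|nud] := boolP (d \is a GRing.unit).
  by rewrite -[RHS]f0 [RHS](reindex_inj (mulrI ud)).
by apply: big1 => x _; rewrite fu// unitrM (negbTE nud).
Qed.

Lemma harmonic_tail_uniform (R : realType) (m : nat) (f : 'Z_m -> R) :
  (1 < m)%N -> on_units f -> \sum_x f x = 0 ->
  exists2 B : R, 0 <= B & forall d N,
    `|harmonic_lim (fun x => f (d * x)) - harmonic_sum (fun x => f (d * x)) N|
      <= B / N.+1%:R.
Proof.
move=> m1 fu f0.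
have /choice[B BP] : forall d : 'Z_m, exists B : R, 0 <= B /\ forall N,
    `|harmonic_lim (fun x => f (d * x)) - harmonic_sum (fun x => f (d * x)) N|
      <= B / N.+1%:R.
  by move=> d; have [B B0 BP] := harmonic_lim_tail m1 (sum_dilate d fu f0); exists B.
exists (\sum_d B d); first by apply: sumr_ge0 => d _; have [] := BP d.
move=> d N; apply: le_trans (proj2 (BP d) N) _; rewrite ler_wpM2r ?invr_ge0//.
by rewrite (bigD1 d)//= lerDl sumr_ge0// => i _; have [] := BP i.
Qed.

Lemma sum_multiples_harmonic (R : realType) (m : nat) (f : 'Z_m -> R) (d M : nat) :
  \sum_(1 <= k < M.+1) f (d * k)%:R / (d * k)%:R =
  d%:R^-1 * harmonic_sum (fun x => f (d%:R * x)) M.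
Proof.
rewrite /harmonic_sum mulr_sumr; apply: eq_bigr => k _.
by rewrite !natrM invfM mulrCA.
Qed.

(** Truncating a series over multiples of [d] at [N %/ d] thus costs [O(1/N)] uniformly in [d]. *)
Lemma inv_floor_le (R : realFieldType) (d N : nat) : (0 < d)%N -> (0 < N)%N ->
  d%:R^-1 * (N %/ d).+1%:R^-1 <= N%:R^-1 :> R.
Proof.
move=> d0 N0; rewrite -invfM -natrM lef_pV2 ?posrE ?ltr0n ?muln_gt0 ?d0//.
by rewrite ler_nat ltnW// mulnC ltn_ceil.
Qed.

(** * Mertens' argument for harmonic sums *)

Section Kernel.
Context {R : realType} {m : nat} (m1 : (1 < m)%N).
Implicit Types f : 'Z_m -> R.

(** The space [K] of the overview; the condition on the sum makes the series converge. *)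
Definition harmonic_kernel f : Prop :=
  [/\ on_units f, \sum_x f x = 0 & forall t, t \is a GRing.unit ->
      harmonic_lim (fun x => f (t * x)) = 0].

Lemma harmonic_lim_dilate_nonunit f (t : 'Z_m) : on_units f ->
  t \isn't a GRing.unit -> harmonic_lim (fun x => f (t * x)) = 0.
Proof.
move=> fu tu; apply: harmonic_limE; rewrite (_ : harmonic_sum _ = fun=> 0).
  exact: cvg_cst.
apply/funext => N; apply: big1 => k _.
by rewrite fu ?mul0r// unitrM (negbTE tu).
Qed.

(** In [sum_mobius_exchange] for [f n / n], every inner sum is minus the tail of a series with limit
    0, hence [O(1/N)], and the sum of [ln N - ln d] over [d <= N] is at most [N]. *)
Lemma kernel_vonMangoldt f : harmonic_kernel f ->
  exists C : R, forall N, (0 < N)%N ->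
  `|f 1 * ln N%:R + \sum_(1 <= n < N.+1) f n%:R * (vonMangoldt R n / n%:R)| <= C.
Proof.
move=> [fu f0 fL]; have [B B0 BP] := harmonic_tail_uniform m1 fu f0.
exists B => N N0; have N0R : 0 < N%:R :> R by rewrite ltr0n.
have := @sum_mobius_exchange R (fun n => f n%:R / n%:R) N N0.
rewrite /= divr1; under eq_bigr do rewrite mulrAC -mulrA; move=> ->.
apply: le_trans (ler_norm_sum _ _ _) _.
apply: (@le_trans _ _ (\sum_(1 <= d < N.+1) (ln N%:R - ln d%:R) * (B / N%:R))).
  apply: ler_sum_nat => d /andP[d0 dN]; rewrite !normrM -mulrA.
  have lnd : 0 <= ln N%:R - ln d%:R :> R.
    by rewrite subr_ge0 ler_ln ?posrE ?ltr0n ?ler_nat//; lia.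
  rewrite -[leRHS]mul1r; apply: ler_pM; rewrite ?mulr_ge0 ?mobius_norm//.
  rewrite (ger0_norm lnd) ler_wpM2l// sum_multiples_harmonic.
  have -> : harmonic_sum (fun x => f (d%:R * x)) (N %/ d) =
    - (harmonic_lim (fun x => f (d%:R * x))
       - harmonic_sum (fun x => f (d%:R * x)) (N %/ d)).
    suff -> : harmonic_lim (fun x => f (d%:R * x)) = 0 by rewrite sub0r opprK.
    have [ud|nud] := boolP (d%:R \is a @GRing.unit 'Z_m); first exact: fL.
    exact: harmonic_lim_dilate_nonunit.
  rewrite normrM normrN ger0_norm ?invr_ge0//.
  apply: le_trans (ler_wpM2l _ (BP _ _)) _; first by rewrite invr_ge0.
  by rewrite mulrCA ler_wpM2l// inv_floor_le.
rewrite -mulr_suml sumrB sumr_const_nat subn1/= -[_ *+ N]mulr_natl.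
rewrite mulrCA -[leRHS]mulr1 ler_wpM2l// ler_pdivrMr// mul1r.
have := sum_ln_ge R N; lra.
Qed.

(** [ln n / n] is not monotone from [n = 1] on, so it is written as [(ln n + 1) / n - 1 / n]. Both
    terms decrease from the value 1, and [abel_bound] applies to each. *)
Lemma sum_ln_div_bounded f : \sum_x f x = 0 ->
  exists C : R, forall N, `|\sum_(1 <= n < N.+1) f n%:R / n%:R * ln n%:R| <= C.
Proof.
move=> f0; have [B fB] := sum_Zp_bounded m1 f0; exists (2 * B) => N.
have E (u : nat -> R) : \sum_(1 <= n < N.+1) f n%:R * u n =
    \sum_(i < N) f (1 + i)%:R * u i.+1.
  by rewrite big_add1 big_mkord.
have h1 := @abel_bound _ (fun i => f (1 + i)%:R) (fun i => i.+1%:R^-1) B N (fB 1%N).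
have h2 := @abel_bound _ (fun i => f (1 + i)%:R)
   (fun i => (ln i.+1%:R + 1) / i.+1%:R) B N (fB 1%N).
rewrite (_ : \sum_(1 <= n < N.+1) _ =
    \sum_(i < N) f (1 + i)%:R * ((ln i.+1%:R + 1) / i.+1%:R) -
    \sum_(i < N) f (1 + i)%:R * i.+1%:R^-1); last first.
  rewrite -sumrB big_add1 big_mkord; apply: eq_bigr => i _.
  by rewrite /= add1n; ring.
apply: le_trans (ler_normB _ _) _.
rewrite mulr_natl mulr2n; apply: lerD.
  apply: le_trans (h2 _ _) _ => [i|i|].
  - rewrite ler_pdivrMr ?ltr0n// mulrAC ler_pdivlMr ?ltr0n//.
    have := @ln_succ_le R i.+1 isT; have := @ln_ge0 R i.+1%:R.
    rewrite ler1n => /(_ isT); rewrite -[i.+2%:R in X in _ -> _ -> X]natr1.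
    rewrite -[i.+2%:R]natr1; set x := i.+1%:R; have x0 : 0 < x by rewrite ltr0n.
    move=> l0 /(ler_wpM2l (ltW x0)); rewrite mulrDr mulfV ?gt_eqF//; nra.
  - by rewrite divr_ge0// addr_ge0// ln_ge0// ler1n.
  - by rewrite ln1 add0r divr1 mulr1.
apply: le_trans (h1 _ _) _ => [i|i|].
- by rewrite lef_pV2 ?posrE ?ltr0n// ler_nat.
- by rewrite invr_ge0.
- by rewrite invr1 mulr1.
Qed.

(** Expanding [ln n] in the bounded sum of [f n * ln n / n] gives the same expression with inner
    sums truncated at [N %/ d]. Replacing these by their limits costs at most [B / N] times
    [chebyshev_psi N]. *)
Lemma vonMangoldt_harmonic_lim f : on_units f -> \sum_x f x = 0 ->
  exists C : R, forall k, `|\sum_(1 <= n < (2 ^ k).+1)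
    harmonic_lim (fun x => f (n%:R * x)) * (vonMangoldt R n / n%:R)| <= C.
Proof.
move=> fu f0; have [B B0 BP] := harmonic_tail_uniform m1 fu f0.
have [C CP] := sum_ln_div_bounded f0; exists (C + B * 4) => k.
set N := (2 ^ k)%N; have N0 : (0 < N)%N by rewrite expn_gt0.
have N0R : 0 < N%:R :> R by rewrite ltr0n.
have := CP N; rewrite (sum_vonMangoldt_exchange (fun n => f n%:R / n%:R)).
under eq_bigr do rewrite sum_multiples_harmonic.
set S := \sum_(_ <= _ < _) _ => SC; set T := \sum_(_ <= _ < _) _.
suff TS : `|T - S| <= B * 4.
  by rewrite -[T](subrK S) addrC; apply: le_trans (ler_normD _ _) (lerD SC TS).
rewrite -sumrB; apply: le_trans (ler_norm_sum _ _ _) _.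
apply: (@le_trans _ _ (\sum_(1 <= d < N.+1) B / N%:R * vonMangoldt R d)).
  apply: ler_sum_nat => d /andP[d0 dN].
  have L0 := vonMangoldt_ge0 R d0.
  rewrite mulrCA -mulrBr [_ * d%:R^-1]mulrC -mulrBr normrM.
  rewrite (ger0_norm L0) [leRHS]mulrC ler_wpM2l//.
  rewrite normrM ger0_norm ?invr_ge0//.
  apply: le_trans (ler_wpM2l _ (BP _ _)) _; first by rewrite invr_ge0.
  by rewrite mulrCA ler_wpM2l// inv_floor_le.
rewrite -mulr_sumr -mulrA ler_wpM2l// ler_pdivrMl//.
by rewrite mulrC; exact: chebyshev_psi_pow2.
Qed.

(** Sum the hypothesis against [vonMangoldt n / n] for [n <= N]. The left side is at least
    [- c (ln N + 4)], the right side is [- e 1 ln N + O(1)]; let [N] tend to infinity along powers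
    of 2. *)
Lemma kernel_projection_le e f (c : R) : harmonic_kernel e ->
  on_units f -> \sum_x f x = 0 -> 0 <= c ->
  (forall g : 'Z_m, (g == 1)%:R - c * (g \is a GRing.unit)%:R =
     e g + harmonic_lim (fun x => f (g * x))) ->
  e 1 <= c.
Proof.
move=> /kernel_vonMangoldt[C1 C1P] fu f0 c0 E.
have [C2 C2P] := vonMangoldt_harmonic_lim fu f0.
rewrite leNgt; apply/negP => ec.
have l2 : 0 < ln 2 :> R by rewrite ln_gt0// ltr1n.
have lin k : (e 1 - c) * (ln 2 *+ k) <= c * 4 + C1 + C2.
  rewrite -lnXn// -natrX.
  have := C1P (2 ^ k)%N; rewrite expn_gt0 => /(_ isT).
  have := C2P k; have := @sum_vonMangoldt_div_pow2 R k.
  set l := ln _; set S := \sum_(_ <= _ < _) _ => S1.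
  set T := \sum_(_ <= _ < _) _ => T1; set U := \sum_(_ <= _ < _) _ => U1.
  have : - (c * S) <= T + U.
    rewrite /S /T /U mulr_sumr -sumrN -big_split/=.
    apply: ler_sum_nat => n /andP[n0 _].
    have L0 : 0 <= vonMangoldt R n / n%:R by rewrite divr_ge0// vonMangoldt_ge0.
    rewrite -mulrDl [_ + e _]addrC -E -mulNr ler_wpM2r//.
    have : (n%:R \is a @GRing.unit 'Z_m)%:R <= 1 :> R by case: (_ \is a _).
    have : 0 <= (n%:R == 1 :> 'Z_m)%:R :> R by [].
    nra.
  move: T1 U1; rewrite !ler_norml => /andP[_ T1] /andP[_ U1].
  have := ler_wpM2l c0 S1; lra.
have [k kP] : exists k : nat, c * 4 + C1 + C2 < (e 1 - c) * (ln 2 *+ k).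
  exists (Num.truncn ((c * 4 + C1 + C2) / ((e 1 - c) * ln 2))).+1.
  have el : 0 < (e 1 - c) * ln 2 by rewrite mulr_gt0// subr_gt0.
  rewrite -[ln 2 *+ _]mulr_natr mulrA [ltRHS]mulrC -(ltr_pdivrMr _ _ el).
  exact: truncnS_gt.
by have := lt_le_trans kP (lin k); rewrite ltxx.
Qed.

End Kernel.

(** * Functions with vanishing harmonic sums *)

(* For a symmetric matrix [S] over a real field, [k *m S = 0] and [k = u *m S]
   give [k *m k^T = 0]; so the kernel and the image of [S] are complementary. *)
Lemma symmetric_ker_im (R : realFieldType) (n : nat) (sg : 'I_n -> 'I_n -> R)
    (h : 'I_n -> R) : (forall s t, sg s t = sg t s) ->
  exists k f : 'I_n -> R, (forall t, \sum_s k s * sg s t = 0) /\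
    (forall t, h t = k t + \sum_s f s * sg s t).
Proof.
move=> sgC; pose S := \matrix_(s, t) sg s t.
have ST : S^T = S by apply/matrixP => i j; rewrite !mxE.
have dir : (kermx S :&: S)%MS = 0.
  set K := (kermx S :&: S)%MS.
  have KS : K *m S = 0 by apply/sub_kermxP; rewrite capmxSl.
  have [W KW] : exists W, K = W *m S by apply/submxP; rewrite capmxSr.
  have KK : K *m K^T = 0 by rewrite {2}KW trmx_mul ST mulmxA KS mul0mx.
  apply/matrixP => i j; move/matrixP: KK => /(_ i i); rewrite !mxE.
  move/eqP; rewrite psumr_eq0 => [|l _]; last by rewrite !mxE -expr2 sqr_ge0.
  move=> /allP/(_ j); rewrite mem_index_enum => /(_ isT)/implyP/(_ isT).
  by rewrite mxE mulf_eq0 orbb => /eqP.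
have : (\row_t h t <= kermx S + S)%MS.
  apply: submx_full; rewrite /row_full.
  have := mxrank_sum_cap (kermx S) S; rewrite dir mxrank0 addn0 mxrank_ker => ->.
  by rewrite subnK// rank_leq_row.
move=> /sub_addsmxP[[u v] /= huv].
exists (fun s => (u *m kermx S) 0 s), (fun s => v 0 s); split => t.
  have /matrixP/(_ 0 t) : u *m kermx S *m S = 0 by rewrite -mulmxA mulmx_ker mulmx0.
  rewrite mxE [RHS]mxE => kS; rewrite -[RHS]kS.
  by apply: eq_bigr => s _; congr (_ * _); rewrite mxE.
move/matrixP: huv => /(_ 0 t); rewrite mxE => ->; rewrite mxE; congr (_ + _).
by rewrite mxE; apply: eq_bigr => s _; rewrite mxE.
Qed.

Lemma cauchy_schwarz_sum (R : realFieldType) (T : finType) (a b : T -> R) :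
  (\sum_x a x * b x) ^+ 2 <= (\sum_x a x ^+ 2) * (\sum_x b x ^+ 2).
Proof.
set A := \sum_x a x ^+ 2; set B := \sum_x b x ^+ 2; set C := \sum_x _.
have B0 : 0 <= B by apply: sumr_ge0 => x _; rewrite sqr_ge0.
have [B00|BN0] := eqVneq B 0.
  have b0 x : b x = 0.
    apply/eqP; rewrite -sqrf_eq0; move/eqP: B00.
    rewrite psumr_eq0 => [/allP/(_ x)|i _]; last by rewrite sqr_ge0.
    by rewrite mem_index_enum => /(_ isT)/implyP/(_ isT).
  by rewrite B00 mulr0 /C big1 ?expr0n// => x _; rewrite b0 mulr0.
have : 0 <= \sum_x (B * a x - C * b x) ^+ 2.
  by apply: sumr_ge0 => x _; rewrite sqr_ge0.
rewrite (eq_bigr (fun x => B ^+ 2 * a x ^+ 2 - 2 * B * C * (a x * b x) +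
   C ^+ 2 * b x ^+ 2)); last by move=> x _; ring.
rewrite big_split/= sumrB -!mulr_sumr -/A -/B -/C.
have -> : B ^+ 2 * A - 2 * B * C * C + C ^+ 2 * B = B * (A * B - C ^+ 2) by ring.
by rewrite pmulr_rge0 ?subr_ge0// lt_def BN0.
Qed.

(** * The reproducing kernel, and why kernel functions are real characters up to scaling *)

Section KernelTheory.
Context {R : realType} {m : nat} (m1 : (1 < m)%N).
Implicit Types (f c : 'Z_m -> R) (g s t x : 'Z_m).

Let unit g := g \is a GRing.unit.
Let phi : R := \sum_(x : 'Z_m) (unit x)%:R.

Let phi_gt0 : 0 < phi.
Proof.
rewrite /phi (bigD1 1)//= /unit unitr1 ltr_wpDr// ?ltr01//.
by apply: sumr_ge0.
Qed.

(* [x == g] minus its mean over the units: the harmonic series of [x == g]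
   alone diverges. *)
Let cdelta g x : R := (x == g)%:R - phi^-1 * (unit x)%:R.

Let sum_cdelta g : \sum_x cdelta g x = 0.
Proof.
rewrite sumrB -mulr_sumr -/phi mulVf ?gt_eqF// (bigD1 g)//= eqxx big1 ?addr0 ?subrr//.
by move=> x /negbTE ->.
Qed.

(** For a unit [g], a regularized sum of [1 / n] over [n = g] modulo [m]; the harmonic limits of
    sum-zero functions are combinations of these. *)
Let ell g : R := harmonic_lim (cdelta g).

Lemma harmonic_lim_zero : harmonic_lim (fun _ : 'Z_m => 0 : R) = 0.
Proof.
apply: harmonic_limE; rewrite (_ : harmonic_sum _ = fun=> 0); first exact: cvg_cst.
by apply/funext => N; apply: big1 => k _; rewrite mul0r.
Qed.

Lemma harmonic_lim_add f c : \sum_x f x = 0 -> \sum_x c x = 0 ->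
  harmonic_lim (fun x => f x + c x) = harmonic_lim f + harmonic_lim c.
Proof.
move=> f0 c0; apply: harmonic_limE.
rewrite (_ : harmonic_sum _ = harmonic_sum f \+ harmonic_sum c).
  by apply: cvgD; exact: cvg_harmonic.
apply/funext => N; rewrite /= /harmonic_sum -big_split/=.
by apply: eq_bigr => k _; rewrite mulrDl.
Qed.

(** The functions [cdelta g] add up to 0 over the units [g]. *)
Let sum_ell : \sum_g (unit g)%:R * ell g = 0.
Proof.
rewrite -harmonic_lim_lin// -[RHS]harmonic_lim_zero; congr harmonic_lim.
apply/funext => x; under eq_bigr do rewrite mulrBr.
rewrite sumrB -mulr_suml -/phi mulrA mulfV ?gt_eqF// mul1r.
rewrite (bigD1 x)//= eqxx mulr1 big1 ?addr0 ?subrr// => i ix.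
by rewrite eq_sym (negbTE ix) mulr0.
Qed.

Let sum_unit_dilate (F : 'Z_m -> R) s : unit s ->
  \sum_t (unit t)%:R * F (s * t) = \sum_t (unit t)%:R * F t.
Proof.
move=> us; rewrite [RHS](reindex_inj (mulrI us))/=.
by apply: eq_bigr => t _; rewrite /unit unitrMr.
Qed.

Let harmonic_lim_ell f t : \sum_x f x = 0 -> unit t ->
  harmonic_lim (fun x => f (t * x)) = \sum_s f s * ell (s / t).
Proof.
move=> f0 ut; rewrite /ell -harmonic_lim_lin//; congr harmonic_lim.
apply/funext => x; under eq_bigr do rewrite mulrBr.
rewrite sumrB -mulr_suml f0 mul0r subr0 (bigD1 (t * x))//=.
rewrite mulrAC mulrV// mul1r eqxx mulr1 big1 ?addr0// => s sx.
case: eqP => [xE|]; last by rewrite mulr0.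
by move: sx; rewrite xE mulrCA mulrV// mulr1 eqxx.
Qed.

(** The harmonic limit as a matrix on the units. Using [s * t] in place of [s / t] makes it
    symmetric, at the cost of an inverse in [sum_sg]. *)
Let sg s t : R := ((unit s && unit t)%:R : R) * ell (s * t).

Let sum_sg f t : on_units f -> \sum_x f x = 0 ->
  \sum_s f s * sg s t = (unit t)%:R * harmonic_lim (fun x => f (t^-1 * x)).
Proof.
move=> fu f0; have [ut|nut] := boolP (unit t).
  rewrite mul1r harmonic_lim_ell ?/unit ?unitrV//; apply: eq_bigr => s _.
  rewrite /sg ut andbT invrK; have [us|nus] := boolP (unit s); first by rewrite mul1r.
  by rewrite fu// !mul0r.
by rewrite mul0r big1// => s _; rewrite /sg (negbTE nut) andbF mul0r mulr0.
Qed.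

Let sum_sg1 t : \sum_s sg s t = 0.
Proof.
have [ut|nut] := boolP (unit t); last first.
  by apply: big1 => s _; rewrite /sg (negbTE nut) andbF mul0r.
rewrite -[RHS]sum_ell -(sum_unit_dilate _ ut); apply: eq_bigr => s _.
by rewrite /sg ut andbT [t * s]mulrC.
Qed.

(** A convolution operator on an abelian group is normal, so it and its transpose have the same
    kernel. Here [P] and [Q] are the two images of [k]: their squares have equal sums over the
    units, and [P] vanishes there. *)
Let kernel_inv (k : 'Z_m -> R) : harmonic_kernel k ->
  harmonic_kernel (fun x => k x^-1).
Proof.
move=> [ku k0 kL]; have k'0 : \sum_x k x^-1 = 0.
  by rewrite -[RHS]k0 [RHS](reindex_inj (can_inj (@invrK _)))/=.
split=> [x xu|//|t ut]; first by rewrite ku// unitrV.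
rewrite (harmonic_lim_ell k'0 ut).
pose P t := \sum_s k s * ell (s * t); pose Q t := \sum_s k s^-1 * ell (s / t).
have P0 t' : unit t' -> P t' = 0.
  move=> ut'; rewrite -[LHS](_ : harmonic_lim (fun x => k (t'^-1 * x)) = _).
    by rewrite kL// unitrV.
  by rewrite harmonic_lim_ell ?/unit ?unitrV//; apply: eq_bigr => s _; rewrite invrK.
have QE t' : Q t' = \sum_s k s * ell (s^-1 / t').
  rewrite /Q (reindex_inj (can_inj (@invrK _)))/=.
  by apply: eq_bigr => s _; rewrite invrK.
have QP : \sum_t (unit t)%:R * Q t ^+ 2 = \sum_t (unit t)%:R * P t ^+ 2.
  have expand (F : 'Z_m -> 'Z_m -> R) :
      \sum_t (unit t)%:R * (\sum_s k s * F s t) ^+ 2 =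
      \sum_s \sum_s' k s * k s' * \sum_t (unit t)%:R * (F s t * F s' t).
    under eq_bigr do rewrite expr2 mulr_suml mulr_sumr.
    rewrite exchange_big/=; apply: eq_bigr => s _.
    under eq_bigr do rewrite !mulr_sumr.
    rewrite exchange_big/=; apply: eq_bigr => s' _.
    by rewrite mulr_sumr; apply: eq_bigr => t' _; ring.
  under eq_bigr do rewrite QE.
  rewrite (expand (fun s t => ell (s^-1 / t))) (expand (fun s t => ell (s * t))).
  apply: eq_bigr => s _; apply: eq_bigr => s' _.
  have [us|nus] := boolP (unit s); last by rewrite (ku s)// !mul0r.
  have [us'|nus'] := boolP (unit s'); last by rewrite (ku s')// mulr0 !mul0r.
  congr (_ * _).
  (* The substitutions [t -> t^-1] and then [t -> s * s' * t] turn the arguments [s^-1 / t] and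
     [s'^-1 / t] into [s' * t] and [s * t]. *)
  rewrite (reindex_inj (can_inj (@invrK _)))/=.
  rewrite (eq_bigr (fun t' => (unit t')%:R *
    (ell (s^-1 / t'^-1) * ell (s'^-1 / t'^-1)))); last first.
    by move=> t' _; rewrite /unit unitrV.
  have uss : unit (s * s') by rewrite /unit unitrM; apply/andP.
  rewrite -(sum_unit_dilate _ uss).
  apply: eq_bigr => t' _; rewrite !invrK [ell _ * ell _]mulrC.
  congr (_ * (ell _ * ell _)).
    by rewrite [s * s']mulrC -mulrA mulKr.
  by rewrite -mulrA mulKr.
have /eqP : \sum_t (unit t)%:R * Q t ^+ 2 = 0.
  rewrite QP big1// => t' _; have [ut'|_] := boolP (unit t'); last by rewrite mul0r.
  by rewrite P0// expr0n mulr0.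
rewrite psumr_eq0 => [|t' _]; last by rewrite mulr_ge0// sqr_ge0.
move=> /allP/(_ t); rewrite mem_index_enum => /(_ isT)/implyP/(_ isT).
by rewrite (ut : unit t) mul1r sqrf_eq0 => /eqP.
Qed.

(** [k] is the component of [cdelta 1] in the kernel of the symmetric matrix [sg]. An element [c] of
    the kernel is orthogonal to the image and has sum 0, so pairing it with [k] or with the delta
    function at 1 gives the same value. *)
Let kernel_reproducing : exists k, [/\ harmonic_kernel k, k 1 <= phi^-1 &
  forall c, harmonic_kernel c -> \sum_s k s * c s = c 1].
Proof.
have sgC s t : sg s t = sg t s by rewrite /sg andbC [t * s]mulrC.
have [k [f0 [kS hE]]] := symmetric_ker_im (cdelta 1) sgC.
have cd_nu t : ~~ unit t -> cdelta 1 t = 0.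
  move=> nut; rewrite /cdelta (negbTE nut) mulr0 subr0.
  by case: eqP nut => // ->; rewrite /unit unitr1.
have sg_nu (F : 'Z_m -> R) t : ~~ unit t -> \sum_s F s * sg s t = 0.
  by move=> nut; rewrite big1// => s _; rewrite /sg (negbTE nut) andbF mul0r mulr0.
have ku : on_units k.
  by move=> t nut; have := hE t; rewrite cd_nu// sg_nu// addr0.
have k0 : \sum_t k t = 0.
  rewrite -[RHS](sum_cdelta 1); under [RHS]eq_bigr do rewrite hE.
  rewrite big_split/= exchange_big/= [X in _ = _ + X]big1 ?addr0// => s _.
  by rewrite -mulr_sumr; under eq_bigr do rewrite sgC; rewrite sum_sg1 mulr0.
have kK : harmonic_kernel k.
  split=> // t ut; have := sum_sg t^-1 ku k0.
  by rewrite kS /unit unitrV ut mul1r invrK.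
(* Restricting [f0] to the units and subtracting its mean does not change its image, as [sg] lives
   on the units and kills constants. *)
pose mu := phi^-1 * \sum_s (unit s)%:R * f0 s.
pose f s := (unit s)%:R * (f0 s - mu).
have fu : on_units f by move=> s nus; rewrite /f /unit (negbTE nus) mul0r.
have f_0 : \sum_x f x = 0.
  rewrite /f; under eq_bigr do rewrite mulrBr.
  by rewrite sumrB -mulr_suml -/phi /mu mulrA mulfV ?gt_eqF// mul1r subrr.
have fS t : \sum_s f s * sg s t = \sum_s f0 s * sg s t.
  transitivity (\sum_s (f0 s * sg s t - mu * sg s t)).
    apply: eq_bigr => s _; rewrite /f /sg.
    by have [us|nus] := boolP (unit s); rewrite ?mul1r ?mulrBl// !(mul0r, mulr0) subrr.
  by rewrite sumrB -mulr_sumr sum_sg1 mulr0 subr0.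
exists k; split=> //.
  rewrite -invr1; apply: (kernel_projection_le m1 (kernel_inv kK) fu f_0).
    by rewrite invr_ge0 ltW.
  (* The decomposition is read at [g^-1] because of the inverse in [sum_sg]; hence [kernel_inv] is
     applied to [k]. *)
  move=> g; transitivity (cdelta 1 g^-1).
    rewrite /cdelta /unit unitrV; congr (_%:R - _).
    by rewrite -(inj_eq (can_inj (@invrK _)) g) invr1.
  rewrite hE; congr (_ + _); rewrite -fS sum_sg// invrK.
  have [ug|nug] := boolP (unit g); first by rewrite /unit unitrV -/(unit g) ug mul1r.
  by rewrite harmonic_lim_dilate_nonunit// mulr0.
move=> c [cu c0 cL].
have cS t : \sum_s c s * sg s t = 0.
  rewrite sum_sg//; have [ut|_] := boolP (unit t); last by rewrite mul0r.
  by rewrite cL ?mulr0// unitrV.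
have : \sum_s cdelta 1 s * c s = c 1.
  rewrite /cdelta; under eq_bigr do rewrite mulrBl.
  rewrite sumrB (bigD1 1)//= mul1r big1 ?addr0; last first.
    by move=> i /negbTE ->; rewrite mul0r.
  rewrite (eq_bigr (fun s => phi^-1 * c s)) -?mulr_sumr ?c0 ?mulr0 ?subr0//.
  move=> s _; have [us|nus] := boolP (unit s); first by rewrite mulr1.
  by rewrite cu// !mulr0.
move=> <-; under [RHS]eq_bigr do rewrite hE mulrDl.
rewrite big_split/= [X in _ = _ + X](_ : _ = 0) ?addr0//.
under eq_bigr do rewrite mulr_suml.
rewrite exchange_big/= big1// => s _.
transitivity (f0 s * \sum_t c t * sg t s); last by rewrite cS mulr0.
by rewrite mulr_sumr; apply: eq_bigr => t _; rewrite sgC; ring.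
Qed.

Lemma kernel_dilate c t : t \is a GRing.unit -> harmonic_kernel c ->
  harmonic_kernel (fun x => c (t * x)).
Proof.
move=> ut [cu c0 cL]; split=> [x xu||s us].
- by rewrite cu// unitrM (negbTE xu) andbF.
- exact: sum_dilate.
- rewrite -[RHS](cL (t * s)) ?unitrM ?ut//; congr harmonic_lim.
  by apply/funext => x; rewrite mulrA.
Qed.

(** Reproducing and Cauchy-Schwarz give [c t ^+ 2 <= k 1 * N2 <= N2 / phi] at every unit [t]. Since
    [N2 / phi] is the mean of [c ^+ 2] over the units, equality holds everywhere. *)
Lemma kernel_norm_constant c : harmonic_kernel c ->
  forall s t, s \is a GRing.unit -> t \is a GRing.unit -> `|c s| = `|c t|.
Proof.
move=> cK; have [k [kK k1 kc]] := kernel_reproducing.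
pose N2 := \sum_x c x ^+ 2.
have N2_dilate t : unit t -> \sum_x c (t * x) ^+ 2 = N2.
  by move=> ut; rewrite /N2 [RHS](reindex_inj (mulrI ut)).
have N20 : 0 <= N2 by apply: sumr_ge0 => x _; rewrite sqr_ge0.
have le t : unit t -> c t ^+ 2 <= phi^-1 * N2.
  move=> ut; rewrite -{1}[t]mulr1 -(kc _ (kernel_dilate ut cK)).
  apply: le_trans (cauchy_schwarz_sum _ _) _; rewrite N2_dilate//.
  by rewrite ler_wpM2r//; under eq_bigr do rewrite expr2; rewrite kc.
have /eqP : \sum_t (unit t)%:R * (phi^-1 * N2 - c t ^+ 2) = 0.
  under eq_bigr do rewrite mulrBr.
  rewrite sumrB -mulr_suml -/phi mulrA mulfV ?gt_eqF// mul1r.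
  apply/eqP; rewrite subr_eq0; apply/eqP; apply: eq_bigr => t _.
  have [ut|nut] := boolP (unit t); first by rewrite mul1r.
  by case: cK => cu _ _; rewrite cu// expr0n mulr0.
rewrite psumr_eq0 => [|t _]; last first.
  have [ut|_] := boolP (unit t); last by rewrite mul0r.
  by rewrite mul1r subr_ge0 le.
move=> /allP E; have {}E t : unit t -> c t ^+ 2 = phi^-1 * N2.
  move=> ut; have := E t; rewrite mem_index_enum => /(_ isT)/implyP/(_ isT).
  by rewrite ut mul1r subr_eq0 => /eqP.
by move=> s t us ut; rewrite -!sqrtr_sqr !E.
Qed.

(** The values at [s], [t] and [s * t] are [c 1] up to sign. Constancy of the absolute value of
    [c x + c (s * x)] fixes the sign at [s * t]: the inconsistent choices force [c 1 = 0]. *)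
Lemma kernel_real_character c : harmonic_kernel c ->
  forall s t, s \is a GRing.unit -> t \is a GRing.unit ->
    c 1 * c (s * t) = c s * c t.
Proof.
move=> cK s t us ut; have [cu c0 cL] := cK; have csK := kernel_dilate us cK.
have [csu cs0 csL] := csK.
have dK : harmonic_kernel (fun x => c x + c (s * x)).
  split=> [x xu||r ur]; first by rewrite cu// csu// addr0.
    by rewrite big_split/= c0 cs0 addr0.
  rewrite (@harmonic_lim_add (fun x => c (r * x)) (fun x => c (s * (r * x)))).
  - by rewrite cL// csL// addr0.
  - exact: sum_dilate.
  - exact: (@sum_dilate _ _ (fun x => c (s * x))).
have h1 := kernel_norm_constant cK us (unitr1 _).
have h2 := kernel_norm_constant cK ut (unitr1 _).
have h3 : `|c (s * t)| = `|c 1|.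
  by apply: kernel_norm_constant => //; rewrite ?unitrM ?us ?unitr1.
have h4 := kernel_norm_constant dK ut (unitr1 _); rewrite /= mulr1 in h4.
move: h1 h2 h3 h4 => /eqP + /eqP + /eqP + /eqP; rewrite !eqr_norm2.
move=> /orP[]/eqP-> /orP[]/eqP-> /orP[]/eqP-> /orP[]/eqP h4; try ring.
all: have -> : c 1 = 0 by lra.
all: ring.
Qed.

End KernelTheory.

(** * Fourier series of the sawtooth function *)

Lemma is_derive_affine (R : realType) (a u : R) :
  is_derive u 1 (fun v : R => a * v) a.
Proof. by apply: is_derive_eq; rewrite /GRing.scale/= mulr1. Qed.

Lemma is_derive_sin_mul (R : realType) (a u : R) :
  is_derive u 1 (fun v : R => sin (a * v)) (a * cos (a * u)).
Proof.
have h := is_derive_affine a u.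
have := @is_derive1_comp R sin ( *%R a) u _ _ (is_derive_sin _) h.
by rewrite mulrC.
Qed.

Lemma is_derive_cos_mul (R : realType) (a u : R) :
  is_derive u 1 (fun v : R => cos (a * v)) (- a * sin (a * u)).
Proof.
have h := is_derive_affine a u.
have := @is_derive1_comp R cos ( *%R a) u _ _ (is_derive_cos _) h.
by rewrite !mulNr [a * sin _]mulrC.
Qed.

Lemma dirichlet_kernel (R : realType) (N : nat) (u : R) :
  sin (2^-1 * u) * (2^-1 + \sum_(i < N) cos (i.+1%:R * u)) =
  2^-1 * sin ((N%:R + 2^-1) * u).
Proof.
elim: N => [|N IH]; first by rewrite big_ord0 addr0 add0r mulrC.
rewrite big_ord_recr/= addrA mulrDr IH.
have -> : (N%:R + 2^-1) * u = N.+1%:R * u - 2^-1 * u :> R by rewrite -natr1; field.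
have -> : (N.+1%:R + 2^-1) * u = N.+1%:R * u + 2^-1 * u by ring.
by rewrite sinB sinD; field.
Qed.

Lemma sin_mul_natpi (R : realType) (n : nat) : sin (n%:R * pi) = 0 :> R.
Proof.
elim: n => [|n IH]; first by rewrite mul0r sin0.
by rewrite -natr1 mulrDl mul1r sinDpi IH oppr0.
Qed.

(** Mean value theorem on [[t, pi]] for [F], the error plus a correction with denominator [2 * a].
    Differentiating the cosine in the correction cancels the Dirichlet kernel, so [F] has derivative
    [O(1/a)]; moreover [F pi = 0]. *)
Lemma sin_sum_estimate (R : realType) (N : nat) (t : R) : 0 < t <= pi ->
  `|\sum_(i < N) i.+1%:R^-1 * sin (i.+1%:R * t) - (pi - t) / 2| <=
  (2 * N%:R + 1)^-1 * (pi / sin (2^-1 * t) ^+ 2 + (sin (2^-1 * t))^-1).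
Proof.
move=> /andP[t0 tpi]; pose a : R := N%:R + 2^-1.
have N0 : 0 <= N%:R :> R by [].
have a0 : 0 < a by rewrite /a; lra.
have sinu u : t <= u <= pi -> 0 < sin (2^-1 * t) <= sin (2^-1 * u).
  move=> /andP[tu upi]; have p0 := @pi_gt0 R; apply/andP; split.
    by apply: sin_gt0_pi; apply/andP; split; lra.
  rewrite leNgt ltr_sin -?leNgt ?in_itv/=; [lra| |]; apply/andP; split; lra.
have s0 : 0 < sin (2^-1 * t).
  by have /andP[] := sinu t (introT andP (conj (lexx t) tpi)).
pose F u := \sum_(i < N) i.+1%:R^-1 * sin (i.+1%:R * u) + (2^-1 * u - pi / 2) +
   (2 * a)^-1 * (cos (a * u) / sin (2^-1 * u)).
pose dF u : R := - (2 * a)^-1 * (2^-1 * cos (a * u) * cos (2^-1 * u) / sin (2^-1 * u) ^+ 2).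
have derF u : t <= u <= pi -> is_derive u 1 F (dF u).
  move=> tu; have /andP[_ su] := sinu u tu; have su0 := lt_le_trans s0 su.
  have h1 i := is_derive_sin_mul (i.+1%:R : R) u.
  have h2 := is_derive_affine (2^-1 : R) u.
  have h3 := is_derive_cos_mul a u.
  have h4 := is_deriveV (lt0r_neq0 su0) (is_derive_sin_mul 2^-1 u).
  have h5 : is_derive u 1 (\sum_(i < N) (i.+1%:R^-1 \*: (fun v : R => sin (i.+1%:R * v))))
      (\sum_(i < N) i.+1%:R^-1 *: (i.+1%:R * cos (i.+1%:R * u))).
    by apply: is_derive_sum => i; apply: is_deriveZ.
  have -> : F = \sum_(i < N) (i.+1%:R^-1 \*: (fun v : R => sin (i.+1%:R * v))) +
    ((fun v => 2^-1 * v) - cst (pi / 2)) +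
    (2 * a)^-1 \*: ((fun v => cos (a * v)) * (fun v => (sin (2^-1 * v))^-1)).
    by apply/funext => v; rewrite /F/= !fctE; congr (_ + _ + _); rewrite fct_sumE.
  apply: is_derive_eq.
  rewrite /GRing.scale/= /dF.
  have -> : \sum_(i < N) i.+1%:R^-1 * (i.+1%:R * cos (i.+1%:R * u)) =
    2^-1 * sin (a * u) / sin (2^-1 * u) - 2^-1.
    have := dirichlet_kernel N u; rewrite -/a => <-.
    rewrite mulrC mulrA mulVf ?gt_eqF// mul1r addrC addKr.
    by apply: eq_bigr => i _; rewrite mulrA mulVf ?mul1r// pnatr_eq0.
  by field; rewrite !gt_eqF//.
have Fpi : F pi = 0.
  rewrite /F big1 ?add0r => [|i _]; last by rewrite sin_mul_natpi mulr0.
  rewrite [X in cos X](_ : _ = N%:R * pi + pi / 2); last by rewrite /a; field.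
  by rewrite cosDpihalf sin_mul_natpi oppr0 mul0r mulr0 addr0; field.
have [c] : exists2 c, c \in `[t, pi]%R & F pi - F t = dF c * (pi - t).
  apply: MVT_segment => //.
    by move=> x; rewrite in_itv/= => /andP[/ltW ? /ltW ?]; apply: derF; apply/andP.
  apply: derivable_within_continuous => x; rewrite in_itv/= => xt.
  by have [] := derF x xt.
rewrite in_itv/= => ct; rewrite Fpi sub0r => Ft.
have /andP[_ sc] := sinu c ct.
have dFc : `|dF c| <= (2 * a)^-1 / sin (2^-1 * t) ^+ 2.
  rewrite /dF normrM normrN [`|(2 * a)^-1|]gtr0_norm ?invr_gt0 ?mulr_gt0//.
  apply: ler_wpM2l; first by rewrite invr_ge0 mulr_ge0 ?ltW.
  rewrite normrM -[leRHS]mul1r; apply: ler_pM => //.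
    rewrite !normrM [`|2^-1|]gtr0_norm ?invr_gt0//.
    have := ler_pM (normr_ge0 _) (normr_ge0 _) (cos_max (a * c)) (cos_max (2^-1 * c)).
    rewrite mulr1; have := normr_ge0 (cos (a * c)).
    have := normr_ge0 (cos (2^-1 * c)); nra.
  rewrite ger0_norm ?invr_ge0 ?sqr_ge0//.
  have sc0 := lt_le_trans s0 sc.
  rewrite lef_pV2 ?posrE ?exprn_gt0//.
  by apply: lerXn2r => //; rewrite nnegrE ltW.
have -> : \sum_(i < N) i.+1%:R^-1 * sin (i.+1%:R * t) - (pi - t) / 2 =
    F t - (2 * a)^-1 * (cos (a * t) / sin (2^-1 * t)) by rewrite /F; field; rewrite !gt_eqF.
have -> : 2 * N%:R + 1 = 2 * a by rewrite /a; field.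
apply: le_trans (ler_normB _ _) _; rewrite [leRHS]mulrDr; apply: lerD.
  rewrite -normrN Ft normrM mulrCA [leRHS]mulrC.
  apply: ler_pM => //; rewrite ger0_norm ?subr_ge0//; lra.
rewrite !normrM [`|(2 * a)^-1|]gtr0_norm ?invr_gt0 ?mulr_gt0//.
apply: ler_wpM2l; first by rewrite invr_ge0 mulr_ge0 ?ltW.
rewrite [`|(sin _)^-1|]gtr0_norm ?invr_gt0//.
by rewrite ler_piMl ?cos_max// invr_ge0 ltW.
Qed.

Lemma sin_add_2pin (R : realType) (a : R) (n : nat) :
  sin (a + 2 * pi * n%:R) = sin a.
Proof.
by rewrite -(periodicn (@sinD2pi R) n a); congr (sin (_ + _)); rewrite mulr_natl mulr_natr.
Qed.

Lemma cos_add_2pin (R : realType) (a : R) (n : nat) :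
  cos (a + 2 * pi * n%:R) = cos a.
Proof.
by rewrite -(periodicn (@cosD2pi R) n a); congr (cos (_ + _)); rewrite mulr_natl mulr_natr.
Qed.

Lemma le_div_succ_eq0 (R : archiRealFieldType) (x C : R) :
  (forall N, `|x| <= C / N.+1%:R) -> x = 0.
Proof.
move=> h; apply/eqP; rewrite -normr_eq0 eq_le normr_ge0 andbT leNgt.
apply/negP => x0; have := h (Num.truncn (C / `|x|)).
by rewrite ler_pdivlMr ?ltr0n// mulrC -ler_pdivlMr// leNgt truncnS_gt.
Qed.

Lemma cvg_of_rate (R : realType) (u : nat -> R) (l C : R) :
  (forall N, `|u N - l| <= (2 * N%:R + 1)^-1 * C) -> u @ \oo --> l.
Proof.
move=> h; apply/cvgrPdist_le => e e0; near=> N.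
rewrite distrC; apply: le_trans (h N) _; rewrite ler_pdivrMl; last first.
  by rewrite ltr_wpDl ?mulr_ge0.
have : C / e <= N%:R by near: N; exact: nbhs_infty_ger.
rewrite ler_pdivrMr// => Ce; apply: le_trans Ce _.
by rewrite ler_wpM2r ?ltW//; have : 0 <= N%:R :> R by []; lra.
Unshelve. all: by end_near. Qed.

Section Trigonometric.
Context {R : realType} {m : nat} (m1 : (1 < m)%N).
Implicit Types x y u : 'Z_m.

Definition zangle x : R := 2 * pi * (x%:R / m%:R).
Definition zsin x : R := sin (zangle x).
Definition zcos x : R := cos (zangle x).

(** The sum of the Fourier series of [sin (k * zangle x) / k]; the value 0 at the jump keeps it
    odd. *)
Definition sawtooth x : R := if x == 0 then 0 else (pi - zangle x) / 2.

Let m0 : m%:R != 0 :> R. Proof. by rewrite pnatr_eq0; case: m m1. Qed.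

Lemma zsin_nat (n : nat) : zsin n%:R = sin (2 * pi * (n%:R / m%:R)).
Proof.
rewrite /zsin /zangle val_Zp_nat// {2}(divn_eq n m).
rewrite -[LHS](@sin_add_2pin _ _ (n %/ m)); congr sin.
by rewrite natrD natrM; field.
Qed.

Lemma zcos_nat (n : nat) : zcos n%:R = cos (2 * pi * (n%:R / m%:R)).
Proof.
rewrite /zcos /zangle val_Zp_nat// {2}(divn_eq n m).
rewrite -[LHS](@cos_add_2pin _ _ (n %/ m)); congr cos.
by rewrite natrD natrM; field.
Qed.

Lemma zsinD x y : zsin (x + y) = zsin x * zcos y + zcos x * zsin y.
Proof.
rewrite -[x]natr_Zp -[y]natr_Zp -natrD !zsin_nat !zcos_nat -sinD; congr sin.
by rewrite natrD; field.
Qed.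

Lemma zcosD x y : zcos (x + y) = zcos x * zcos y - zsin x * zsin y.
Proof.
rewrite -[x]natr_Zp -[y]natr_Zp -natrD !zsin_nat !zcos_nat -cosD; congr cos.
by rewrite natrD; field.
Qed.

Lemma zsin0 : zsin 0 = 0.
Proof. by rewrite /zsin /zangle mul0r mulr0 sin0. Qed.

Lemma zcos0 : zcos 0 = 1.
Proof. by rewrite /zcos /zangle mul0r mulr0 cos0. Qed.

Lemma zcos2Dzsin2 x : zcos x ^+ 2 + zsin x ^+ 2 = 1.
Proof. exact: cos2Dsin2. Qed.

(** The addition formulas for [x + - x = 0] form a linear system of determinant [cos^2 + sin^2 = 1];
    no representative of [- x] is computed. *)
Lemma zsinN x : zsin (- x) = - zsin x.
Proof.
have := zsinD x (- x); have := zcosD x (- x); rewrite subrr zsin0 zcos0.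
have := zcos2Dzsin2 x; set a := zcos x; set b := zsin x; set c := zcos _.
set d := zsin _ => h1 h2 h3.
have -> : d = d * (a ^+ 2 + b ^+ 2) by rewrite h1 mulr1.
have -> : d * (a ^+ 2 + b ^+ 2) = a * (b * c + a * d) - b * (a * c - b * d) by ring.
by rewrite -h2 -h3 mulr0 sub0r mulr1.
Qed.

Lemma zcosN x : zcos (- x) = zcos x.
Proof.
have := zsinD x (- x); have := zcosD x (- x); rewrite subrr zsin0 zcos0.
have := zcos2Dzsin2 x; set a := zcos x; set b := zsin x; set c := zcos _.
set d := zsin _ => h1 h2 h3.
have -> : c = c * (a ^+ 2 + b ^+ 2) by rewrite h1 mulr1.
have -> : c * (a ^+ 2 + b ^+ 2) = b * (b * c + a * d) + a * (a * c - b * d) by ring.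
by rewrite -h2 -h3 mulr0 add0r mulr1.
Qed.

Lemma zangle_bounds x : x != 0 -> 0 < zangle x < 2 * pi.
Proof.
move=> x0; have xn : (0 < x)%N by rewrite lt0n.
have p0 := @pi_gt0 R; have m0' : 0 < m%:R :> R by rewrite ltr0n; lia.
have p2 : 0 < 2 * pi :> R by lra.
apply/andP; split; first by rewrite /zangle mulr_gt0// divr_gt0// ltr0n.
rewrite -[ltRHS]mulr1 ltr_pM2l// ltr_pdivrMr// mul1r ltr_nat.
by rewrite -{2}(Zp_cast m1) ltn_ord.
Qed.

Lemma zcos_neq1 x : x != 0 -> zcos x != 1.
Proof.
move=> /zangle_bounds/andP[h1 h2]; have p0 := @pi_gt0 R.
rewrite /zcos [zangle x](_ : _ = (zangle x / 2) *+ 2); last first.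
  by rewrite mulr2n; field.
have s0 : 0 < sin (zangle x / 2).
  by apply: sin_gt0_pi; apply/andP; split; lra.
rewrite cos_mulr2n cos2sin2; apply/eqP => h.
have : 0 < sin (zangle x / 2) ^+ 2 by rewrite exprn_gt0.
move: h; rewrite mulr2n; lra.
Qed.

(* [step] rotates the angles by [u], so the sum [sum (zcos + i zsin)] is
   multiplied by a number different from 1. *)
Lemma sum_rotation (I : finType) (ang : I -> 'Z_m) (step : I -> I) u :
  injective step -> (forall i, ang (step i) = ang i + u) -> u != 0 ->
  \sum_i zsin (ang i) = 0 /\ \sum_i zcos (ang i) = 0.
Proof.
move=> step_inj angE u0; set S := \sum_i _; set C := \sum_i _.
have S' : S = S * zcos u + C * zsin u.
  rewrite {1}/S (reindex_inj step_inj)/= /S /C !mulr_suml -big_split/=.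
  by apply: eq_bigr => i _; rewrite angE zsinD.
have C' : C = C * zcos u - S * zsin u.
  rewrite {1}/C (reindex_inj step_inj)/= /S /C !mulr_suml -sumrB/=.
  by apply: eq_bigr => i _; rewrite angE zcosD.
have : (S ^+ 2 + C ^+ 2) * (1 - zcos u) = 0.
  have -> : (S ^+ 2 + C ^+ 2) * (1 - zcos u) =
    S * (S - (S * zcos u + C * zsin u)) + C * (C - (C * zcos u - S * zsin u)).
    by ring.
  by rewrite -S' -C' !subrr !mulr0 addr0.
move/eqP; rewrite mulf_eq0 subr_eq0 [1 == _]eq_sym (negbTE (zcos_neq1 u0)) orbF.
by rewrite paddr_eq0 ?sqr_ge0// !sqrf_eq0 => /andP[/eqP-> /eqP->].
Qed.

Lemma sum_zcos u : \sum_y zcos (y * u) = m%:R * (u == 0)%:R.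
Proof.
have [->|u0] := eqVneq u 0.
  under eq_bigr do rewrite mulr0 zcos0.
  by rewrite mulr1 sumr_const card_ord Zp_cast.
rewrite mulr0; apply: (proj2 (@sum_rotation _ _ (fun y => y + 1) u _ _ _)) => //.
  exact: addIr.
by move=> y; rewrite mulrDl mul1r.
Qed.

Lemma zsin_orthogonal x z :
  \sum_y zsin (y * x) * zsin (y * z) = m%:R / 2 * ((x == z)%:R - (x == - z)%:R).
Proof.
rewrite -[x == z]subr_eq0 -[x == - z]subr_eq0 opprK mulrAC mulrBr -!sum_zcos.
rewrite -sumrB mulr_suml; apply: eq_bigr => y _.
by rewrite mulrBr mulrDr !zcosD zcosN zsinN; field.
Qed.

Definition sine_transform (a : 'Z_m -> R) (n : 'Z_m) : R :=
  \sum_x a x * zsin (n * x).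

Lemma sine_transformN a n : sine_transform a (- n) = - sine_transform a n.
Proof.
by rewrite -sumrN; apply: eq_bigr => x _; rewrite mulNr zsinN mulrN.
Qed.

(** Used with [z = 1], which is plain inversion, and with [z = p], which gives sums of [a] over
    classes modulo [p]. *)
Lemma sine_transform_inv a z u :
  \sum_n sine_transform a (z * n) * zsin (n * u) =
  m%:R / 2 * (\sum_(x | z * x == u) a x - \sum_(x | z * x == - u) a x).
Proof.
under eq_bigr do rewrite mulr_suml.
rewrite exchange_big/= (eq_bigr (fun x =>
  m%:R / 2 * ((if z * x == u then a x else 0) - (if z * x == - u then a x else 0)))).
  by rewrite -mulr_sumr sumrB -!big_mkcond.
move=> x _; transitivity (a x * (\sum_n zsin (n * (z * x)) * zsin (n * u))).
  by rewrite mulr_sumr; apply: eq_bigr => n _; rewrite mulrA mulrCA mulrA [z * n]mulrC.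
rewrite zsin_orthogonal mulrCA; congr (_ * _).
by case: eqP => _; case: eqP => _; rewrite ?subr0 ?subrr ?sub0r ?mulr0 ?mulr1 ?mulrN1.
Qed.

Lemma odd_sum0 (f : 'Z_m -> R) : (forall x, f (- x) = - f x) -> \sum_x f x = 0.
Proof.
move=> fN; have : \sum_x f x = - \sum_x f x.
  by rewrite {1}(reindex_inj oppr_inj)/= -sumrN; apply: eq_bigr => x _.
lra.
Qed.

Lemma zangleN x : x != 0 -> zangle (- x) = 2 * pi - zangle x.
Proof.
move=> x0; have xm : (x < m)%N by rewrite -{2}(Zp_cast m1) ltn_ord.
have xN : - x = (m - x)%:R :> 'Z_m.
  by rewrite natrB ?(ltnW xm)// natr_modulus// sub0r natr_Zp.
have xn : (0 < x)%N by rewrite lt0n.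
rewrite /zangle xN val_Zp_nat// modn_small; last by lia.
by rewrite natrB ?(ltnW xm)//; field.
Qed.

Lemma sawtoothN x : sawtooth (- x) = - sawtooth x.
Proof.
rewrite /sawtooth oppr_eq0; case: eqP => [_|/eqP x0]; first by rewrite oppr0.
by rewrite zangleN//; field.
Qed.

Lemma harmonic_sum_zsin x N : harmonic_sum (fun y => zsin (y * x)) N =
  \sum_(i < N) i.+1%:R^-1 * sin (i.+1%:R * zangle x).
Proof.
rewrite /harmonic_sum big_add1 big_mkord; apply: eq_bigr => i _ /=.
rewrite mulrC; congr (_ * _); rewrite -{1}[x]natr_Zp -natrM zsin_nat natrM.
by congr sin; rewrite /zangle; field.
Qed.

(** [sin_sum_estimate] covers angles up to [pi]; the others follow by oddness. *)
Lemma cvg_sawtooth x : harmonic_sum (fun y => zsin (y * x)) @ \oo --> sawtooth x.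
Proof.
have [->|x0] := eqVneq x 0.
  rewrite /sawtooth eqxx (_ : harmonic_sum _ = fun=> 0); first exact: cvg_cst.
  by apply/funext => N; apply: big1 => k _; rewrite mulr0 zsin0 mul0r.
have base y : y != 0 -> zangle y <= pi ->
    harmonic_sum (fun z => zsin (z * y)) @ \oo --> sawtooth y.
  move=> y0 yp; have /andP[h1 h2] := zangle_bounds y0.
  rewrite /sawtooth (negbTE y0); apply: cvg_of_rate => N; rewrite harmonic_sum_zsin.
  by apply: sin_sum_estimate; rewrite h1.
have [xp|xp] := leP (zangle x) pi; first exact: base.
rewrite -[x]opprK sawtoothN.
rewrite (_ : harmonic_sum _ = - harmonic_sum (fun y => zsin (y * (- x)))).
  by apply: cvgN; apply: base; rewrite ?oppr_eq0// zangleN//; lra.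
apply/funext => N; rewrite !fctE /harmonic_sum -sumrN; apply: eq_bigr => k _.
by rewrite !mulrN opprK zsinN mulNr opprK.
Qed.

Lemma harmonic_lim_sine_transform (a : 'Z_m -> R) t :
  harmonic_lim (fun y => sine_transform a (t * y)) = \sum_x a x * sawtooth (t * x).
Proof.
rewrite /sine_transform harmonic_lim_lin//.
  apply: eq_bigr => x _; congr (_ * _); rewrite -[RHS](harmonic_limE (@cvg_sawtooth (t * x))).
  by congr harmonic_lim; apply/funext => y; rewrite mulrCA mulrA.
move=> x; apply: odd_sum0 => y; by rewrite mulrN mulNr zsinN.
Qed.

End Trigonometric.

(** * The units modulo the square of a prime *)

Lemma exprD_nilpotent (R : comNzRingType) (x z : R) (n : nat) : (0 < n)%N ->
  z * z = 0 -> (x + z) ^+ n = x ^+ n + x ^+ n.-1 * z *+ n.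
Proof.
move=> + z2; case: n => // n _; elim: n => [|n IH].
  by rewrite !expr1 expr0 mul1r mulr1n.
rewrite exprSr IH !mulrDl !mulrDr -!exprSr /=.
rewrite [x ^+ n * z *+ n.+1 * z]mulrnAl -[x ^+ n * z * z]mulrA z2 mulr0 mul0rn addr0.
by rewrite mulrnAl -mulrA [z * x]mulrC mulrA -exprSr -addrA -mulrS.
Qed.

Section PrimeSquare.
Context {p : nat} (p_prime : prime p).

Let p0 : (0 < p)%N := prime_gt0 p_prime.
Let p1 : (1 < p)%N := prime_gt1 p_prime.
Let m := (p ^ 2)%N.

Lemma prime_square_gt1 : (1 < m)%N.
Proof. by rewrite /m (ltn_exp2l 0). Qed.

Let m1 := prime_square_gt1.
Let pz : 'Z_m := p%:R.

Lemma unit_prime_squareE (k : nat) : ((k%:R : 'Z_m) \is a GRing.unit) = ~~ (p %| k)%N.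
Proof. by rewrite unitZpE// coprime_pexpl// prime_coprime. Qed.

Lemma mulpp : pz * pz = 0.
Proof. by rewrite /pz -natrM -(natr_modulus m1) /m expnS expn1. Qed.

Lemma pz_neq0 : pz != 0.
Proof.
apply/eqP => /(congr1 (fun x : 'Z_m => x : nat)).
rewrite val_Zp_nat// modn_small /=; first by move=> p00; move: p0; rewrite p00.
by rewrite /m -{1}[p]expn1 ltn_exp2l.
Qed.

Lemma nonunitP (x : 'Z_m) : reflect (exists y, x = pz * y) (x \isn't a GRing.unit).
Proof.
apply: (iffP idP) => [|[y ->]].
  rewrite -{1}[x]natr_Zp unit_prime_squareE negbK => /dvdnP[k xk].
  by exists k%:R; rewrite -{1}[x]natr_Zp xk natrM mulrC.
by rewrite unitrM negb_and /pz unit_prime_squareE dvdnn.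
Qed.

Lemma mulp_nonunit (x : 'Z_m) : x \isn't a GRing.unit -> pz * x = 0.
Proof. by move=> /nonunitP[y ->]; rewrite mulrA mulpp mul0r. Qed.

Lemma mulp_eq0 (x : 'Z_m) : pz * x = 0 -> x \isn't a GRing.unit.
Proof.
move=> px; apply/negP => ux; have := pz_neq0.
by rewrite -[pz](mulrK ux) px mul0r eqxx.
Qed.

Lemma unit_addp (x j : 'Z_m) : (x + pz * j \is a GRing.unit) = (x \is a GRing.unit).
Proof.
have h y i : y \is a GRing.unit -> y + pz * i \is a GRing.unit.
  move=> uy; apply: contraT => /mulp_nonunit; rewrite mulrDr mulrA mulpp mul0r addr0.
  by move=> /mulp_eq0; rewrite uy.
apply/idP/idP; last exact: h.
by move=> /(h _ (- j)); rewrite mulrN addrK.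
Qed.

(** With [p - 1 = 4k], the polynomial [X^(2k) - 1] has too few roots to contain all nonzero [z]. If
    [z^(2k) <> 1] then [z^(2k) = -1], as its square is 1, and [z^k] is the witness. *)
Lemma minus_one_square_mod_prime : (4 %| p.-1)%N -> exists y : nat, (p %| y ^ 2 + 1)%N.
Proof.
move=> /dvdnP[k pk].
have [z zk z0] : exists2 z : 'F_p, z ^+ (2 * k) != 1 & z != 0.
  apply: contrapT => H.
  have all1 (z : 'F_p) : z != 0 -> z ^+ (2 * k) == 1.
    move=> z0; apply/negPn/negP => h; by apply: H; exists z.
  have := @max_unity_roots 'F_p (2 * k) (enum [pred z : 'F_p | z != 0]).
  have k0 : (0 < 2 * k)%N by move: p1 pk; lia.
  rewrite k0 enum_uniq -cardE => /(_ isT).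
  have -> : #|[pred z : 'F_p | z != 0]| = p.-1.
    by have := cardC1 (0 : 'F_p); rewrite card_Fp.
  have all2 : all (2 * k).-unity_root (enum [pred z : 'F_p | z != 0]).
    by apply/allP => z; rewrite mem_enum inE => /all1 h; rewrite unity_rootE.
  by move=> /(_ all2 isT); move: k0; lia.
exists (z ^+ k : 'F_p).
rewrite (dvdn_pcharf (pchar_Fp p_prime)) natrD natrX natr_Zp -exprM mulnC.
suff : (z ^+ (2 * k) - 1) * (z ^+ (2 * k) + 1) == 0.
  by rewrite mulf_eq0 subr_eq0 (negbTE zk).
rewrite -subr_sqr expr1n -exprM subr_eq0.
have -> : (2 * k * 2)%N = p.-1 by lia.
have := expf_card z; rewrite card_Fp// => h.
by apply/eqP/(mulfI z0); rewrite mulr1 -exprS prednK.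
Qed.

(** A root modulo [p] is lifted by raising it to the power [p]: [(-1 + p k)^p = (-1)^p] modulo
    [p^2], and [p] is odd. *)
Lemma minus_one_square : (4 %| p.-1)%N -> exists y : 'Z_m, y * y = -1.
Proof.
move=> p4; have [y /dvdnP[k yk]] := minus_one_square_mod_prime p4.
exists (y%:R ^+ p).
have y2 : (y%:R : 'Z_m) ^+ 2 = -1 + pz * k%:R.
  apply: (addIr 1); rewrite addrAC addNr add0r -natrX -[1]/(1%:R) -natrD yk.
  by rewrite natrM mulrC.
rewrite -expr2 -exprM mulnC exprM y2 exprD_nilpotent//; last first.
  by rewrite mulrACA mulpp mul0r.
rewrite -mulr_natr -mulrA mulrAC mulpp mul0r mulr0 addr0.
rewrite -signr_odd (_ : odd p = true) ?expr1//.
move: p4 => /dvdnP[c pc]; have -> : p = (4 * c).+1 by rewrite mulnC -pc prednK.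
by rewrite /= oddM.
Qed.

(** Pair [x] with [m - x]; there are [(p - 1) p] units. *)
Lemma sum_units_double :
  (2 * \sum_(x : 'Z_m | x \is a GRing.unit) (x : nat) = m * (p.-1 * p))%N.
Proof.
have E : (\sum_(x : 'Z_m | x \is a GRing.unit) (x : nat) =
          \sum_(x : 'Z_m | x \is a GRing.unit) (m - x))%N.
  rewrite (reindex_inj oppr_inj); apply: eq_big => [x|x]; rewrite unitrN// => ux.
  have x0 : x != 0 by apply: contraTneq ux => ->; rewrite unitr0.
  have xm : (x < m)%N by rewrite -{2}(Zp_cast m1) ltn_ord.
  have -> : - x = (m - x)%:R :> 'Z_m.
    by rewrite natrB ?(ltnW xm)// natr_modulus// sub0r natr_Zp.
  rewrite val_Zp_nat// modn_small//; have : (0 < x)%N by rewrite lt0n.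
  lia.
rewrite mul2n -addnn {2}E -big_split/=.
transitivity (\sum_(x : 'Z_m | x \is a GRing.unit) m)%N.
  apply: eq_bigr => x _; rewrite subnKC// ltnW// -{2}(Zp_cast m1) ltn_ord//.
rewrite big_const iter_addn_0; congr (_ * _)%N.
have := totient_pfactor p_prime (isT : (0 < 2)%N); rewrite expn1 => <-.
rewrite totient_count_coprime big_mkord -sum1_card big_mkcond/=.
have F (G : nat -> nat) : (\sum_(i < m) G i = \sum_(i < (Zp_trunc m).+2) G i)%N.
  by rewrite Zp_cast.
rewrite (F (fun i => coprime m i : nat)); apply: eq_bigr => x _.
by rewrite -{1}[x]natr_Zp unitZpE//; case: coprime.
Qed.

End PrimeSquare.

(** * Absence of nonzero odd kernel functions modulo p^2 *)

Section PrimeSquareKernel.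
Context {R : realType} {p : nat} (p_prime : prime p) (p_odd : odd p).

Let m := (p ^ 2)%N.
Let m1 : (1 < m)%N := prime_square_gt1 p_prime.
Let pz : 'Z_m := p%:R.
Let pR0 : p%:R != 0 :> R.
Proof. by rewrite pnatr_eq0 -lt0n prime_gt0. Qed.
Let u (x : 'Z_m) : R := (x \is a GRing.unit)%:R.

Implicit Types (f g a c : 'Z_m -> R) (x y t : 'Z_m).

Lemma harmonic_lim_scale (b : R) f : \sum_x f x = 0 ->
  harmonic_lim (fun x => b * f x) = b * harmonic_lim f.
Proof.
move=> f0; have := @harmonic_lim_lin R m unit (fun=> b) (fun=> f) m1 (fun=> f0).
rewrite (_ : (fun x => \sum_i b * f x) = (fun x => b * f x)).
  by move=> ->; rewrite big_const card_unit/= addr0.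
by apply/funext => x; rewrite big_const card_unit/= addr0.
Qed.

(** The series is separated into [n] prime to [p] and [n = p k]. For the multiples of [p], the
    partial sum up to [p * N] equals [1 / p] times the dilated one up to [N]. *)
Lemma harmonic_lim_split g : (forall x, g (- x) = - g x) ->
  harmonic_lim g = harmonic_lim (fun x => u x * g x) +
    p%:R^-1 * harmonic_lim (fun x => g (pz * x)).
Proof.
move=> gN.
have ug0 : \sum_x u x * g x = 0.
  by apply: odd_sum0 => x; rewrite /u unitrN gN mulrN.
have ng0 : \sum_x (1 - u x) * g x = 0.
  by apply: odd_sum0 => x; rewrite /u unitrN gN mulrN.
have pg0 : \sum_x g (pz * x) = 0 by apply: odd_sum0 => x; rewrite mulrN gN.
have {1}-> : g = fun x => u x * g x + (1 - u x) * g x.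
  by apply/funext => x; rewrite -mulrDl addrC subrK mul1r.
rewrite harmonic_lim_add//; congr (_ + _); apply/eqP; rewrite -subr_eq0; apply/eqP.
have [B1 B10 B1P] := harmonic_lim_tail m1 ng0.
have [B2 B20 B2P] := harmonic_lim_tail m1 pg0.
apply: (@le_div_succ_eq0 _ _ (B1 + B2)) => N.
have E : harmonic_sum (fun x => (1 - u x) * g x) (p * N) =
    p%:R^-1 * harmonic_sum (fun x => g (pz * x)) N.
  rewrite /harmonic_sum (eq_bigr (fun k =>
     if (p %| k)%N then g k%:R / k%:R else 0)); last first.
    move=> k _; rewrite /u unit_prime_squareE//.
    by case: (p %| k)%N; rewrite ?subr0 ?mul1r// subrr !mul0r.
  rewrite -big_mkcond (sum_multiples (fun k => g k%:R / k%:R)) ?prime_gt0//.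
  rewrite mulKn ?prime_gt0// mulr_sumr; apply: eq_bigr => k _.
  by rewrite !natrM invfM mulrCA.
have := B1P (p * N)%N; have := B2P N; rewrite E.
set L2 := harmonic_lim _; set L1 := harmonic_lim _; set S := harmonic_sum _ _ => h2 h1.
have -> : L1 - p%:R^-1 * L2 = (L1 - p%:R^-1 * S) - p%:R^-1 * (L2 - S) by ring.
apply: le_trans (ler_normB _ _) _; rewrite mulrDl; apply: lerD.
  apply: le_trans h1 _; rewrite ler_wpM2l// lef_pV2 ?posrE ?ltr0n// ler_nat ltnS.
  by rewrite leq_pmull// prime_gt0.
rewrite normrM ger0_norm ?invr_ge0//; apply: le_trans h2.
by rewrite ler_piMl// invf_le1 ?ler1n ?ltr0n prime_gt0.
Qed.

(** The sum is the harmonic limit of the sine transform [X] of [c]. As [c] is multiplicative up to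
    scaling, [X] behaves like a Gauss sum: both [X] on the units and [x |-> X (p x)] are multiples
    of [c], whose harmonic limit is 0. *)
Let kernel_odd_character c : harmonic_kernel c -> c 1 != 0 ->
  (forall x, c (- x) = - c x) -> \sum_x c x * sawtooth x = 0.
Proof.
move=> cK c10 cN; have [cu c0 cL] := cK.
have cM := kernel_real_character m1 cK.
have c_sq x : x \is a GRing.unit -> c x * c x = c 1 * c 1.
  move=> ux; have := kernel_norm_constant m1 cK ux (unitr1 _).
  by rewrite -!expr2 -(real_normK (num_real (c x))) => ->; rewrite real_normK ?num_real.
have cV x : x \is a GRing.unit -> c x^-1 = c x.
  move=> ux; apply: (mulfI (_ : c x != 0)).
    by rewrite -normr_eq0 (kernel_norm_constant m1 cK ux (unitr1 _)) normr_eq0.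
  by rewrite -cM ?unitrV// mulrV// [RHS]c_sq.
pose X := sine_transform c.
have X_dilate (z t : 'Z_m) : t \is a GRing.unit -> X (z * t) = c t * (X z / c 1).
  move=> ut; transitivity (\sum_x c t / c 1 * (c x * zsin (z * x))); last first.
    by rewrite -mulr_sumr mulrAC mulrA.
  have uVt : t^-1 \is a GRing.unit by rewrite unitrV.
  rewrite /X /sine_transform (reindex_inj (mulrI uVt))/=; apply: eq_bigr => x _.
  rewrite -[z * t * _]mulrA mulVKr// mulrA; congr (_ * _).
  have [ux|nux] := boolP (x \is a GRing.unit).
    by apply: (mulfI c10); rewrite cM// cV//; field.
  by rewrite [c x]cu// cu ?mulr0// unitrM (negbTE nux) andbF.
have XN x : X (- x) = - X x by exact: sine_transformN.
have L0 : harmonic_lim X = 0.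
  rewrite harmonic_lim_split//.
  have -> : (fun x => u x * X x) = (fun x => X 1 / c 1 * c x).
    apply/funext => x; rewrite /u; have [ux|nux] := boolP (x \is a GRing.unit).
      by rewrite mul1r -[x in LHS]mul1r X_dilate// mulrC.
    by rewrite (cu x)// mulr0 mul0r.
  have -> : (fun x => X (pz * x)) = (fun x => X pz / c 1 * c x).
    apply/funext => x; have [ux|nux] := boolP (x \is a GRing.unit).
      by rewrite X_dilate// mulrC.
    rewrite (cu x)// mulr0 mulp_nonunit// /X /sine_transform big1// => y _.
    by rewrite mul0r zsin0 mulr0.
  have L1 : harmonic_lim c = 0.
    by rewrite -[RHS](cL 1 (unitr1 _)); congr harmonic_lim; apply/funext => x; rewrite mul1r.
  by rewrite !harmonic_lim_scale// L1 !mulr0 addr0.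
have := harmonic_lim_sine_transform m1 c 1.
under [RHS]eq_bigr do rewrite mul1r; move=> <-.
by rewrite -[RHS]L0; congr harmonic_lim; apply/funext => x; rewrite mul1r.
Qed.

(* If [c 1 <> 0] then [c / c 1] is an odd character with values in {1, -1}.
   The sawtooth sum gives [sum c(x) x = 0], so [sum x] over the units is even
   and [p = 1 %[mod 4]]; but then -1 is a square and no such character is odd. *)
Lemma kernel_no_odd c : harmonic_kernel c -> (forall x, c (- x) = - c x) ->
  forall x, c x = 0.
Proof.
move=> cK cN; have [cu c0 cL] := cK.
have [c10|c10] := eqVneq (c 1) 0.
  move=> x; have [ux|nux] := boolP (x \is a GRing.unit); last exact: cu.
  have := kernel_norm_constant m1 cK ux (unitr1 _).
  by rewrite c10 normr0 => /eqP; rewrite normr_eq0 => /eqP.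
exfalso; have S0 := kernel_odd_character cK c10 cN.
have W0 : \sum_x c x * (x : nat)%:R = 0.
  have m0 : m%:R != 0 :> R by rewrite pnatr_eq0 -lt0n; apply: ltn_trans m1.
  have p0 := @pi_gt0 R.
  have : \sum_x c x * sawtooth x =
      pi / 2 * \sum_x c x - pi / m%:R * \sum_x c x * (x : nat)%:R.
    rewrite !mulr_sumr -sumrB; apply: eq_bigr => x _; rewrite /sawtooth.
    case: eqP => [->|_]; last by rewrite /zangle; field.
    by rewrite cu ?unitr0// !(mul0r, mulr0) subrr.
  rewrite S0 c0 mulr0 sub0r => /esym/eqP; rewrite oppr_eq0 mulf_eq0.
  by rewrite mulf_eq0 gt_eqF//= invr_eq0 (negbTE m0)/= => /eqP.
have even : (\sum_(x : 'Z_m | x \is a GRing.unit) (x : nat) =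
    2 * \sum_(x : 'Z_m | c x == c 1%R) (x : nat))%N.
  apply/eqP; rewrite -(eqr_nat R) natrM !natr_sum; apply/eqP.
  (* Adding the sum of [c x / c 1 * x], which is 0, gives each unit weight 2 or 0. *)
  transitivity (\sum_(x : 'Z_m | x \is a GRing.unit) (x : nat)%:R +
      (c 1)^-1 * \sum_x c x * (x : nat)%:R); first by rewrite W0 mulr0 addr0.
  rewrite !mulr_sumr big_mkcond/=.
  rewrite [RHS]big_mkcond/= -big_split/=; apply: eq_bigr => x _.
  have [ux|nux] := boolP (x \is a GRing.unit); last first.
    by rewrite (cu x)// eq_sym (negbTE c10) mul0r mulr0 addr0.
  have := kernel_norm_constant m1 cK ux (unitr1 _) => /eqP; rewrite eqr_norm2.
  case: eqP => [-> _|_ /= /eqP ->]; first by field.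
  by field.
have := sum_units_double p_prime; rewrite -/m even => dbl.
have p4 : (4 %| p.-1)%N.
  have : (4 %| m * (p.-1 * p))%N by rewrite -dbl mulnA dvdn_mulr.
  have cop : coprime 4 p by rewrite (@coprime_pexpl 2 2 p) // coprime2n.
  rewrite Gauss_dvdr; last by rewrite /m coprimeXr.
  by rewrite Gauss_dvdl.
have [y yy] := minus_one_square p_prime p4.
have uy : y \is a GRing.unit.
  by have := unitrN1 ('Z_m); rewrite -yy unitrM => /andP[].
have := kernel_real_character m1 cK uy uy; rewrite yy cN.
have := kernel_norm_constant m1 cK uy (unitr1 _) => /eqP; rewrite eqr_norm2.
move=> cy h; have : c 1 * c 1 = 0.
  by case/orP: cy h => /eqP ->; lra.
by move/eqP; rewrite mulf_eq0 orbb (negbTE c10).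
Qed.

End PrimeSquareKernel.

(** * Solutions of the sawtooth relations modulo p^2 *)

Section SawtoothRelation.
Context {R : realType} {p : nat} (p_prime : prime p) (p_odd : odd p).

Let m := (p ^ 2)%N.
Let m1 : (1 < m)%N := prime_square_gt1 p_prime.
Let pz : 'Z_m := p%:R.
Let pR0 : p%:R != 0 :> R.
Proof. by rewrite pnatr_eq0 -lt0n prime_gt0. Qed.
Let mR0 : m%:R != 0 :> R.
Proof. by rewrite pnatr_eq0 -lt0n; apply: ltn_trans m1. Qed.

Let sum_cst (r : R) : \sum_(j : 'Z_m) r = m%:R * r.
Proof. by rewrite sumr_const card_ord Zp_cast// mulr_natl. Qed.

Variables (a : 'Z_m -> R)
  (aE : forall t, t \is a GRing.unit -> \sum_x a x * sawtooth (t * x) = 0).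

Let u (x : 'Z_m) : R := (x \is a GRing.unit)%:R.
(** [D] comes from the part of [a] on the multiples of [p], [E] from the part on the units. *)
Let A := sine_transform a.
Let D := sine_transform (fun x => (1 - u x) * a x).
Let E := sine_transform (fun x => u x * a x).

Let AED n : A n = E n + D n.
Proof.
rewrite /A /E /D /sine_transform -big_split/=; apply: eq_bigr => x _.
by rewrite -!mulrDl [_ + (1 - _)]addrC subrK mul1r.
Qed.

Let AN n : A (- n) = - A n. Proof. exact: sine_transformN. Qed.
Let EN n : E (- n) = - E n. Proof. exact: sine_transformN. Qed.
Let DN n : D (- n) = - D n. Proof. exact: sine_transformN. Qed.

Let A0 : A 0 = 0.
Proof. by rewrite /A /sine_transform big1// => x _; rewrite mul0r zsin0 mulr0. Qed.

Let Dp n : D (pz * n) = 0.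
Proof.
rewrite /D /sine_transform big1// => x _; rewrite /u.
have [ux|nux] := boolP (x \is a GRing.unit); first by rewrite subrr !mul0r.
by rewrite [pz * n * x]mulrAC mulp_nonunit// mul0r zsin0 mulr0.
Qed.

(** Dilating by [1 + p j] fixes the multiples of [p] and rotates the term of a unit [x] by [j] times
    a nonzero angle, so the average keeps [D] only. The factor is [m] because [j] runs over all of
    ['Z_m]. *)
Let average t y : t \is a GRing.unit -> y \is a GRing.unit ->
  \sum_(j : 'Z_m) A (t * (1 + pz * j) * y) = m%:R * D (t * y).
Proof.
move=> ut uy; rewrite /A /D /sine_transform exchange_big mulr_sumr/=.
apply: eq_bigr => x _; rewrite -mulr_sumr /u.
have angE j : t * (1 + pz * j) * y * x = t * y * x + j * (t * y * (pz * x)) by ring.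
under eq_bigr do rewrite angE.
have [ux|nux] := boolP (x \is a GRing.unit).
  rewrite subrr !mul0r mulr0; apply/eqP; rewrite mulf_eq0; apply/orP; right; apply/eqP.
  apply: (proj1 (@sum_rotation R m m1 _ (fun j => t * y * x + j * (t * y * (pz * x)))
    (fun j => j + 1) (t * y * (pz * x)) _ _ _)).
  - exact: addIr.
  - by move=> j; rewrite mulrDl mul1r addrA.
  - have uty : t * y \is a GRing.unit by rewrite unitrM ut.
    apply: contra (pz_neq0 p_prime) => /eqP h; apply/eqP.
    by apply: (mulIr ux); apply: (mulrI uty); rewrite /= mul0r mulr0.
under eq_bigr do rewrite mulp_nonunit// !mulr0 addr0.
rewrite sum_cst subr0 mul1r; ring.
Qed.

Let lim_uA t : t \is a GRing.unit ->
  harmonic_lim (fun y => u y * A (t * y)) =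
  - (p%:R^-1 * harmonic_lim (fun y => A (pz * (t * y)))).
Proof.
move=> ut; have := harmonic_lim_sine_transform m1 a t; rewrite aE// -/A.
rewrite (harmonic_lim_split p_prime); last by move=> x; rewrite mulrN AN.
have -> : (fun x => A (t * (p%:R * x))) = (fun y => A (pz * (t * y))).
  by apply/funext => y; rewrite mulrCA.
by move/eqP; rewrite addr_eq0 => /eqP.
Qed.

Let uD0 t : \sum_y u y * D (t * y) = 0.
Proof. by apply: odd_sum0 => y; rewrite /u unitrN mulrN DN mulrN. Qed.

Let uA0 t : \sum_y u y * A (t * y) = 0.
Proof. by apply: odd_sum0 => y; rewrite /u unitrN mulrN AN mulrN. Qed.

Let pA0 t : \sum_y A (pz * (t * y)) = 0.
Proof. by apply: odd_sum0 => y; rewrite !mulrN AN. Qed.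

(** [lim_uA] averaged over the dilations by [1 + p j]: its right-hand side does not change, since
    [p * p = 0]. *)
Let lim_uD t : t \is a GRing.unit ->
  harmonic_lim (fun y => u y * D (t * y)) =
  - (p%:R^-1 * harmonic_lim (fun y => A (pz * (t * y)))).
Proof.
move=> ut; apply: (mulfI mR0).
rewrite -harmonic_lim_scale//.
pose t_ (j : 'Z_m) := t * (1 + pz * j).
have -> : (fun y => m%:R * (u y * D (t * y))) =
    (fun y => \sum_(j : 'Z_m) 1 * (u y * A (t_ j * y))).
  apply/funext => y; rewrite /u; have [uy|_] := boolP (y \is a GRing.unit).
    by rewrite mul1r -average//; apply: eq_bigr => j _; rewrite !mul1r.
  by rewrite mul0r mulr0 big1// => j _; rewrite mul0r mulr0.
rewrite (@harmonic_lim_lin _ _ _ (fun=> 1) (fun j y => u y * A (t_ j * y)))//.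
rewrite (eq_bigr (fun=> - (p%:R^-1 * harmonic_lim (fun y => A (pz * (t * y)))))).
  exact: sum_cst.
move=> j _; rewrite mul1r lim_uA; last by rewrite unitrM ut unit_addp// unitr1.
congr (- (_ * harmonic_lim _)); apply/funext => y; congr A.
have -> : pz * (t_ j * y) = pz * (t * y) + pz * pz * (t * j * y) by rewrite /t_; ring.
by rewrite mulpp// mul0r addr0.
Qed.

(** By [lim_uA] and [lim_uD] the harmonic limits of [A - D = E] on the units vanish, and [E] is
    odd. *)
Let E_unit n : n \is a GRing.unit -> E n = 0.
Proof.
move=> un; have uE0 t : \sum_y u y * E (t * y) = 0.
  by apply: odd_sum0 => y; rewrite /u unitrN mulrN EN mulrN.
have K : harmonic_kernel (fun y => u y * E y).
  split=> [x /negbTE xu||t ut]; first by rewrite /u xu mul0r.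
    by have := uE0 1; under eq_bigr do rewrite mul1r.
  have -> : (fun x => u (t * x) * E (t * x)) =
      (fun x => u x * A (t * x) + -1 * (u x * D (t * x))).
    apply/funext => x; rewrite /u unitrM ut/= AED; ring.
  rewrite harmonic_lim_add// ?harmonic_lim_scale// ?lim_uA// ?lim_uD//.
    by rewrite mulN1r subrr.
  by rewrite -mulr_sumr uD0 mulr0.
have := kernel_no_odd p_prime p_odd K _ n; rewrite /u un mul1r; apply.
by move=> x; rewrite unitrN EN mulrN.
Qed.

(** By [lim_uD] the odd function [K] lies in the kernel, so it vanishes; on multiples of [p], [A]
    equals [E]. For a nonunit [n] both sides are 0. *)
Let D_E n : p%:R * D n = - E (pz * n).
Proof.
have [un|nun] := boolP (n \is a GRing.unit); last first.
  have [y ->] := nonunitP p_prime _ nun.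
  have := AED (pz * (pz * y)); rewrite !Dp addr0 mulr0 mulrA mulpp// mul0r A0.
  by move=> <-; rewrite oppr0.
pose K y := p%:R * (u y * D y) + A (pz * y).
have KN y : K (- y) = - K y.
  by rewrite /K /u unitrN DN !mulrN AN -opprD.
have Ku : on_units K.
  move=> x nux; rewrite /K /u (negbTE nux) mul0r mulr0 add0r.
  by rewrite mulp_nonunit.
have KK : harmonic_kernel K.
  split=> [//||t ut]; first exact: odd_sum0.
  have -> : (fun x => K (t * x)) =
      (fun x => p%:R * (u x * D (t * x)) + A (pz * (t * x))).
    by apply/funext => x; rewrite /K /u unitrM ut.
  rewrite harmonic_lim_add// ?harmonic_lim_scale// ?lim_uD//.
    by rewrite mulrN mulVKf// addNr.
  by rewrite -mulr_sumr uD0 mulr0.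
have := kernel_no_odd p_prime p_odd KK KN n; rewrite /K /u un mul1r AED Dp addr0.
by move/eqP; rewrite addr_eq0 => /eqP.
Qed.

Let al v := a v - a (- v).

Let EE v : v \is a GRing.unit ->
  \sum_n E n * zsin (n * v) = m%:R / 2 * al v.
Proof.
move=> uv; have := sine_transform_inv m1 (fun x => u x * a x) 1 v.
under eq_bigr do rewrite mul1r; move=> ->.
have one w : \sum_(x | 1 * x == w) u x * a x = u w * a w.
  by under eq_bigl do rewrite mul1r; rewrite big_pred1_eq.
by rewrite !one /u unitrN uv !mul1r.
Qed.

(** In the inversion formula only nonunit [n] contribute, by [E_unit], and then [n * p = 0]. *)
Lemma sawtooth_relation_periodic v j : v \is a GRing.unit ->
  al (v + pz * j) = al v.
Proof.
move=> uv; have uv' : v + pz * j \is a GRing.unit by rewrite unit_addp.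
have h : m%:R / 2 != 0 :> R by rewrite mulf_neq0// invr_eq0.
apply: (mulfI h); rewrite -!EE//; apply: eq_bigr => n _.
have [un|nun] := boolP (n \is a GRing.unit); first by rewrite E_unit// !mul0r.
by rewrite mulrDr mulrA [n * pz]mulrC mulp_nonunit// mul0r addr0.
Qed.

(** Inverting [D = - E (p n) / p] at [p v] gives the sum of [al] over [S], the class of [v] modulo
    [p], where [al] is constant. Hence [k = #|S| / p]. *)
Lemma sawtooth_relation_multiple v : v \is a GRing.unit ->
  exists2 k : R, 0 < k & al (pz * v) = - k * al v.
Proof.
move=> uv; pose S := [pred x : 'Z_m | pz * x == pz * v].
have Su x : S x -> exists j, x = v + pz * j.
  move=> /eqP pxv; have : pz * (x - v) = 0 by rewrite mulrBr pxv subrr.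
  by move=> /(mulp_eq0 p_prime)/(nonunitP p_prime)[j xv]; exists j; rewrite -xv addrC subrK.
exists (p%:R^-1 * #|S|%:R).
  have S0 : (0 < #|S|)%N by apply/card_gt0P; exists v; rewrite inE.
  by rewrite mulr_gt0 ?invr_gt0 ?ltr0n ?S0// prime_gt0.
have h : m%:R / 2 != 0 :> R by rewrite mulf_neq0// invr_eq0.
have nu w : u (pz * w) = 0.
  by rewrite /u unitrM (negbTE (_ : pz \isn't a GRing.unit))// unit_prime_squareE ?dvdnn.
have := sine_transform_inv m1 (fun x => (1 - u x) * a x) 1 (pz * v).
have one w : \sum_(x | 1 * x == w) (1 - u x) * a x = (1 - u w) * a w.
  by under eq_bigl do rewrite mul1r; rewrite big_pred1_eq.
have nuN w : u (- (pz * w)) = 0 by rewrite -mulrN nu.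
rewrite !one nu nuN subr0 !mul1r -/(al (pz * v)) => h1.
apply: (mulfI h); rewrite -h1.
have := sine_transform_inv m1 (fun x => u x * a x) pz (pz * v).
have -> : \sum_(x | pz * x == pz * v) u x * a x -
    \sum_(x | pz * x == - (pz * v)) u x * a x = #|S|%:R * al v.
  rewrite [X in _ - X](reindex_inj oppr_inj)/=.
  under [X in _ - X]eq_bigl do rewrite mulrN eqr_opp.
  rewrite -sumrB mulr_natl -sumr_const; apply: eq_bigr => x Sx.
  have [j xE] := Su x Sx; have ux : x \is a GRing.unit by rewrite xE unit_addp.
  by rewrite /u unitrN ux !mul1r -/(al x) xE sawtooth_relation_periodic.
move=> h2; transitivity (- p%:R^-1 * (m%:R / 2 * (#|S|%:R * al v))); last by field.
rewrite -h2 mulr_sumr; apply: eq_bigr => n _; rewrite mul1r [RHS]mulrA; congr (_ * _).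
by apply: (mulfI pR0); rewrite D_E mulNr mulrN mulVKf.
Qed.

End SawtoothRelation.

(** * The tuples beta_i *)

Local Close Scope ring_scope.
Local Close Scope classical_set_scope.
Local Open Scope nat_scope.

Lemma mem_beta (p i x : nat) :
  (x \in beta p i) = (x == p * (p - i)) || (x \in [seq i + j * p | j <- iota 0 p]).
Proof. by rewrite mem_sort mem_rcons inE. Qed.

Lemma perm_beta (p i : nat) :
  perm_eq (beta p i) (p * (p - i) :: [seq i + j * p | j <- iota 0 p]).
Proof. by rewrite /beta perm_sort perm_rcons. Qed.

Lemma size_beta (p i : nat) : size (beta p i) = p + 1.
Proof. by rewrite (perm_size (perm_beta p i)) /= size_map size_iota addn1. Qed.

Section Beta.
Context {p i : nat} (p_prime : prime p) (p_odd : odd p) (i_bd : 1 <= i <= p - 1).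

Let p0 : 0 < p := prime_gt0 p_prime.
Let i0 : 0 < i. Proof. by case/andP: i_bd. Qed.
Let ip : i < p. Proof. by move: i_bd p0; clear; lia. Qed.
Let pi : p %| i = false. Proof. by rewrite gtnNdvd. Qed.

Lemma mem_beta_mod (x : nat) : x \in beta p i ->
  x %% p = (if p %| x then 0 else i).
Proof.
rewrite mem_beta => /orP[/eqP->|/mapP[j _ ->]].
  by rewrite dvdn_mulr// modnMr.
by rewrite dvdn_addl ?dvdn_mull// pi addnC modnMDl modn_small.
Qed.

Lemma count_beta : count (dvdn p) (beta p i) = 1.
Proof.
rewrite (permP (perm_beta p i))/= dvdn_mulr// count_map.
rewrite (eq_count (a2 := pred0)) ?count_pred0//= => j.
by rewrite /= dvdn_addl ?dvdn_mull// pi.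
Qed.

Lemma beta_uniq : uniq (beta p i).
Proof.
rewrite (perm_uniq (perm_beta p i))/=; apply/andP; split.
  apply/mapP => -[j _ /(congr1 (dvdn p))].
  by rewrite dvdn_mulr// dvdn_addl ?dvdn_mull// pi.
rewrite map_inj_uniq ?iota_uniq// => j k /eqP.
by rewrite eqn_add2l eqn_pmul2r// => /eqP.
Qed.

Lemma beta_sorted : sorted ltn (beta p i).
Proof. by rewrite ltn_sorted_uniq_leq beta_uniq sort_sorted//; exact: leq_total. Qed.

Lemma beta_bounds (x : nat) : x \in beta p i -> 1 <= x <= p ^ 2 - 1.
Proof.
clear p_odd; have pp : p ^ 2 = p * p by rewrite expnS expn1.
rewrite mem_beta pp => /orP[/eqP->|/mapP[j]].
  have : p * (p - i) < p * p by rewrite ltn_pmul2l//; lia.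
  have : 0 < p * (p - i) by rewrite muln_gt0 p0; lia.
  lia.
rewrite mem_iota add0n => /andP[_ jp] ->.
have : j.+1 * p <= p * p by rewrite leq_pmul2r.
rewrite mulSn; lia.
Qed.

Lemma mem_beta_of_mod (x : nat) : x < p ^ 2 -> x %% p = i -> x \in beta p i.
Proof.
move=> xm xi; rewrite mem_beta; apply/orP; right; apply/mapP; exists (x %/ p).
  by rewrite mem_iota add0n ltn_divLR// -[p * p]/(p * (p ^ 1)) -expnS.
by rewrite addnC {1}(divn_eq x p) xi.
Qed.

Lemma sum_beta : \sum_(x <- beta p i) x = p ^ 2 * ((p + 1) %/ 2).
Proof.
rewrite (perm_big _ (perm_beta p i)) big_cons big_map big_split/=.
rewrite big_const_seq count_predT size_iota iter_addn_0 -big_distrl/=.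
have -> : \sum_(j <- iota 0 p) j = p * p.-1./2.
  by have := bin2_sum p; rewrite /index_iota subn0 => ->; rewrite bin2odd.
have [h ph] : exists h, p = h.*2.+1.
  by exists p./2; rewrite -[LHS]odd_double_half p_odd.
have -> : (p + 1) %/ 2 = h.+1 by rewrite ph; lia.
have -> : p.-1./2 = h by rewrite ph /= doubleK.
have : p * (p - i) + i * p = p * p.
  by rewrite mulnC -mulnDl subnK// ltnW.
rewrite expnS expn1 mulnS; lia.
Qed.

(** Modulo [p] the sum is [k * i], with [k <= p] the number of entries prime to [p]. So [k] is 0 or
    [p], and there is at most one further entry; as the size is even and [p] is odd, [s] is empty or
    everything. *)
Lemma subseq_beta_sum (s : seq nat) : subseq s (beta p i) -> s <> [::] ->
  s <> beta p i -> ~~ odd (size s) -> ~~ (p %| \sum_(x <- s) x).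
Proof.
move=> sb s0 sbeta sodd; apply/negP => ps.
pose k := count (predC (dvdn p)) s.
have sk : \sum_(x <- s) x = k * i %[mod p].
  have : {subset s <= beta p i} := mem_subseq sb.
  rewrite /k; elim: (s) => [|x t IH] h; first by rewrite big_nil.
  rewrite big_cons /= mulnDl -modnDm IH => [|y yt]; last by rewrite h// inE yt orbT.
  rewrite (mem_beta_mod (h x (mem_head _ _))); case: ifP => _.
    by rewrite mul0n !add0n modn_mod.
  by rewrite mul1n modnDmr.
have kp : k <= p.
  have := leq_count_subseq (predC (dvdn p)) sb.
  have := count_predC (dvdn p) (beta p i); rewrite size_beta count_beta addnC => /eqP.
  by rewrite eqn_add2r => /eqP ->.
have pk : p %| k.
  move: ps; rewrite /dvdn sk -/(dvdn p (k * i)) Euclid_dvdM// pi orbF//.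
have c1 : count (dvdn p) s <= 1 by rewrite -count_beta leq_count_subseq.
have szs := count_predC (dvdn p) s; rewrite -/k in szs.
case: (posnP k) => [k0|k_gt0].
  move: szs sodd; rewrite k0 addn0 => szs.
  case: (count (dvdn p) s) c1 szs => [|[|//]] _ szs; rewrite -szs//.
  by move=> _; apply: s0; apply/nilP; rewrite /nilp -szs.
have kE : k = p by apply/eqP; rewrite eqn_leq kp dvdn_leq.
apply: sbeta; apply/eqP; rewrite -(size_subseq_leqif sb) size_beta.
move: szs sodd; rewrite kE; case: (count (dvdn p) s) c1 => [|[|//]] _ <-.
  by rewrite add0n p_odd.
by rewrite addnC.
Qed.

(** Entries are 0 or [i] modulo [p]. A pair containing the entry [i] has sum [i] or [2 i] modulo
    [p], never 0. *)
Lemma beta_exceptional : exceptional (p ^ 2) (beta p i).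
Proof.
move=> [q qperm q0].
have ib : i \in beta p i.
  apply: mem_beta_of_mod; rewrite ?modn_small//.
  by apply: leq_trans ip _; rewrite expnS leq_pmulr// expn_gt0 p0.
have := ib; rewrite -(perm_mem qperm) => /flattenP[/= _ /mapP[z zq ->]] iz.
have zb : {subset [:: z.1; z.2] <= beta p i}.
  move=> y yz; rewrite -(perm_mem qperm); apply/flattenP.
  by exists [:: z.1; z.2] => //; apply/mapP; exists z.
have z1 := mem_beta_mod (zb z.1 (mem_head _ _)).
have z2 := mem_beta_mod (zb z.2 (mem_last z.1 [:: z.2])).
have sum0 : (z.1 + z.2) %% p = 0.
  by rewrite -(@modn_dvdm (p ^ 2)) ?(q0 z zq) ?mod0n// expnS dvdn_mulr.
move: sum0; rewrite -modnDm z1 z2.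
have ip' : p %| i + i = false.
  rewrite addnn -mul2n Euclid_dvdM// pi orbF.
  apply/negP => /(dvdn_leq (isT : 0 < 2)) p2.
  have p2' : p = 2 by have := prime_gt1 p_prime; lia.
  by move: p_odd; rewrite p2'.
case: ifP => d1; case: ifP => d2.
- move: iz; rewrite !inE => /orP[] /eqP iE; first by move: d1; rewrite -iE pi.
  by move: d2; rewrite -iE pi.
- by rewrite add0n modn_small//; lia.
- by rewrite addn0 modn_small//; lia.
- by move/eqP; rewrite -/(dvdn p (i + i)) ip'.
Qed.

End Beta.

Section BetaDilate.
Context {p i : nat} (p_prime : prime p) (i_bd : 1 <= i <= p - 1).

Let p0 : 0 < p := prime_gt0 p_prime.
Let ip : i < p. Proof. by move: i_bd p0; clear; lia. Qed.
Let pi : p %| i = false. Proof. by rewrite gtnNdvd//; case/andP: i_bd. Qed.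
Let m1 : 1 < p ^ 2 := prime_square_gt1 p_prime.

(** Here [r] is [t * i] modulo [p]. Inclusion is enough, as both sides have [p + 1] distinct
    entries. *)
Lemma beta_dilate (t : 'Z_(p ^ 2)) : (t \is a GRing.unit)%R ->
  exists2 r, 1 <= r <= p - 1 &
    perm_eq [seq nat_of_ord (t * x%:R)%R | x <- beta p i] (beta p r).
Proof.
move=> ut; pose r := (t * i) %% p.
have pt : p %| t = false.
  by apply/negbTE; rewrite -(unit_prime_squareE p_prime) natr_Zp.
have r_bd : 1 <= r <= p - 1.
  have rp : r < p by rewrite ltn_mod.
  have r0 : r != 0 by rewrite -/(dvdn p (t * i)) Euclid_dvdM// pt pi.
  lia.
exists r => //.
have valE x : nat_of_ord (t * x%:R)%R = (t * x) %% p ^ 2.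
  by rewrite -{1}[t]natr_Zp -natrM val_Zp_nat.
have sub : {subset [seq nat_of_ord (t * x%:R)%R | x <- beta p i] <= beta p r}.
  move=> _ /mapP[x xb ->]; rewrite valE.
  have [px|px] := boolP (p %| x); last first.
    apply: (mem_beta_of_mod p_prime); first by rewrite ltn_mod; lia.
    rewrite modn_dvdm ?expnS ?dvdn_mulr// -modnMmr.
    by rewrite (mem_beta_mod p_prime i_bd xb) (negbTE px).
  move: xb px; rewrite mem_beta => /orP[/eqP-> _|/mapP[j _ ->]]; last first.
    by rewrite dvdn_addl ?dvdn_mull// pi.
  rewrite mem_beta; apply/orP; left.
  have mulE n : (n * (p * (p - i))) %% p ^ 2 = p * ((n * (p - i)) %% p).
    by rewrite expnS expn1 mulnCA -muln_modr.
  rewrite mulE eqn_pmul2l//.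
  have : (t * (p - i) + t * i) %% p = 0.
    by rewrite -mulnDr subnK ?modnMl// ltnW.
  rewrite -modnDm -/r; set s := (t * (p - i)) %% p => sr.
  have sp : s < p by rewrite ltn_mod.
  have : p %| s + r by rewrite /dvdn sr.
  (* [s + r] is a multiple of [p] strictly between 0 and [2 p], hence equals [p]. *)
  move=> /dvdnP[c cE].
  have c2 : c < 2 by rewrite -(ltn_pmul2r p0) -cE; move: sp r_bd; clear; lia.
  have c0 : 0 < c by case: c cE {c2} => //; move: r_bd; clear; lia.
  have c1 : c = 1 by move: c0 c2; clear; lia.
  by apply/eqP; move: cE; rewrite c1 mul1n; clear; lia.
have un : uniq [seq nat_of_ord (t * x%:R)%R | x <- beta p i].
  rewrite map_inj_in_uniq ?beta_uniq// => x y.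
  move=> /(beta_bounds p_prime i_bd) xb /(beta_bounds p_prime i_bd) yb.
  move=> /val_inj/(mulrI ut) /(congr1 (fun z : 'Z_(p ^ 2) => z : nat)).
  by rewrite !val_Zp_nat// !modn_small//; lia.
apply: uniq_perm => //; first exact: beta_uniq.
by have [|//] := uniq_min_size un sub; rewrite size_map !size_beta.
Qed.

End BetaDilate.

Lemma subseq_of_sorted (s b : seq nat) : sorted ltn s -> sorted ltn b ->
  {subset s <= b} -> subseq s b.
Proof.
move=> ss sb sub; have -> : s = [seq x <- b | x \in s]; last exact: filter_subseq.
apply: (irr_sorted_eq ltn_trans ltnn) => // [|x].
  by apply: sorted_filter => //; exact: ltn_trans.
by rewrite mem_filter /=; case: (boolP (x \in s)) => // /sub ->.
Qed.

(* Pair each entry [x < m - x] with [m - x]. *)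
Lemma symmetric_not_exceptional (m : nat) (b : seq nat) : odd m -> uniq b ->
  (forall x, x \in b -> 1 <= x <= m - 1) ->
  (forall x, x \in b -> m - x \in b) -> ~ exceptional m b.
Proof.
move=> modd ub bd sym; apply.
exists [seq (x, m - x) | x <- b & x < m - x]; last first.
  move=> z /mapP[x]; rewrite mem_filter => /andP[_ xb] -> /=.
  by rewrite subnKC ?modnn ?mod0n//; have := bd x xb; lia.
apply: (@perm_trans _ ([seq x <- b | x < m - x] ++ [seq x <- b | ~~ (x < m - x)])).
  rewrite -map_comp /=.
  apply: (@perm_trans _ ([seq x <- b | x < m - x] ++
      [seq m - x | x <- b & x < m - x])).
    elim: [seq x <- b | x < m - x] => //= x s IH.
    rewrite perm_cons -(cat1s _ [seq m - x | x <- s]) perm_sym perm_catCA /=.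
    by rewrite perm_cons perm_sym.
  rewrite perm_cat2l; apply: uniq_perm.
  - rewrite map_inj_in_uniq ?filter_uniq// => x y.
    by rewrite !mem_filter => /andP[_ /bd xb] /andP[_ /bd yb]; lia.
  - by rewrite filter_uniq.
  - move=> y; rewrite mem_filter; apply/mapP/andP => [[x]|[yx yb]].
      rewrite mem_filter => /andP[xm xb] ->; have := bd x xb.
      by split; [lia|exact: sym].
    exists (m - y); last by have := bd y yb; lia.
    rewrite mem_filter sym// andbT; have := bd y yb.
    suff : y <> m - y by lia.
    move=> yy; have mE : m = y.*2 by lia.
    by move: modd; rewrite mE odd_double.
by rewrite perm_filterC.
Qed.

Lemma inB_sum_values (m d : nat) (b : seq nat) (t : 'Z_m) : 1 < m ->
  weight t b = d%:R%R -> \sum_(x <- b) (nat_of_ord (t * x%:R)%R) = d * m.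
Proof.
move=> m1; rewrite /weight -mulr_suml => h.
have m0 : (m%:R != 0 :> rat)%R by rewrite pnatr_eq0; lia.
apply/eqP; rewrite -(eqr_nat rat) natr_sum natrM; apply/eqP.
by rewrite -h divfK.
Qed.

(** Each of the [2 d] entries contributes [pi / 2] minus [pi / m] times its dilated residue, and
    these residues sum to [d * m]. *)
Lemma inB_sawtooth (R : realType) (m d : nat) (b : seq nat) (t : 'Z_m) :
  1 < m -> inB m d b -> (t \is a GRing.unit)%R ->
  (\sum_(x : 'Z_m) ((nat_of_ord x \in b)%:R : R) * sawtooth (t * x) = 0)%R.
Proof.
move=> m1 [szb [/allP bd bs] _ bw] ut.
have bm x : x \in b -> x < m by move=> /bd; lia.
have ub : uniq b by apply: sorted_uniq bs; [exact: ltn_trans|exact: ltnn].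
have -> : (\sum_(x : 'Z_m) ((nat_of_ord x \in b)%:R : R) * sawtooth (t * x) =
    \sum_(x <- b) (sawtooth (t * x%:R) : R))%R.
  rewrite (eq_bigr (fun x : 'Z_m =>
    if nat_of_ord x \in b then sawtooth (t * x) else 0)%R); last first.
    by move=> x _; case: ifP; rewrite ?mul1r ?mul0r.
  rewrite -big_mkcond -big_filter -[RHS](big_map (fun x => x%:R : 'Z_m)%R xpredT
    (fun x => sawtooth (t * x)%R : R)); apply: perm_big; apply: uniq_perm.
  - by rewrite filter_uniq// index_enum_uniq.
  - rewrite map_inj_in_uniq// => x y xb yb /(congr1 (@nat_of_ord _)).
    by rewrite !val_Zp_nat// !modn_small ?bm.
  - move=> x; rewrite mem_filter mem_index_enum andbT; apply/idP/mapP => [xb|[y yb ->]].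
      by exists (nat_of_ord x) => //; rewrite natr_Zp.
    by rewrite val_Zp_nat// modn_small ?bm.
rewrite (eq_big_seq (fun x => pi / 2 - pi / m%:R *
    (nat_of_ord (t * x%:R)%R)%:R)%R); last first.
  move=> x xb; rewrite /sawtooth; case: eqP => [tx|_].
    have : (x%:R = 0 :> 'Z_m)%R by apply: (mulrI ut); rewrite mulr0.
    move=> /(congr1 (@nat_of_ord _)); rewrite val_Zp_nat// modn_small ?bm// => x0.
    by have := bd x xb; rewrite x0.
  have m0 : (m%:R != 0 :> R)%R by rewrite pnatr_eq0; lia.
  by rewrite /zangle; field.
rewrite sumrB [X in (_ - X)%R](_ : _ = pi / m%:R * (d * m)%:R)%R; last first.
  by rewrite -mulr_sumr -natr_sum (inB_sum_values m1 (bw t ut)).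
rewrite big_const_seq count_predT szb iter_addr addr0 -mulr_natr !natrM.
have m0 : (m%:R != 0 :> R)%R by rewrite pnatr_eq0; lia.
by field.
Qed.

(** * Exceptional tuples contain some beta_i *)

Section Classification.
Context {p d : nat} (p_prime : prime p) (p_odd : odd p).
Variables (b : seq nat) (bB : inB (p ^ 2) d b).

Let m1 : 1 < p ^ 2 := prime_square_gt1 p_prime.
Let p0 : 0 < p := prime_gt0 p_prime.
(** The statement mentions no real field, so the analysis is applied to a concrete one. *)
Let R := Rdefinitions.R.
Let a (x : 'Z_(p ^ 2)) : R := (nat_of_ord x \in b)%:R%R.
Let aE (t : 'Z_(p ^ 2)) (ut : (t \is a GRing.unit)%R) :
  (\sum_x a x * sawtooth (t * x) = 0)%R := @inB_sawtooth R _ _ _ t m1 bB ut.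

Let al_gt0 v : (0 < a v - a (- v))%R -> nat_of_ord v \in b.
Proof.
rewrite /a; case: (_ \in b) => //; case: (_ \in b);
by rewrite ?subr0 ?sub0r ?subrr ?ltr0N1 ?ltxx.
Qed.

(** Periodicity makes the difference positive at every [i + j p]. It is negative at [p v], hence
    positive at [- p v], which is [p (p - i)]. *)
Let beta_sub_of_unit (v : 'Z_(p ^ 2)) : (v \is a GRing.unit)%R ->
  (0 < a v - a (- v))%R ->
  exists2 i, 1 <= i <= p - 1 & {subset beta p i <= b}.
Proof.
move=> uv alv; pose i := (v : nat) %% p.
have vE : nat_of_ord v = (v : nat) %/ p * p + i by exact: divn_eq.
have i_bd : 1 <= i <= p - 1.
  have ip : i < p by rewrite ltn_mod.
  have : i != 0.
    by move: uv; rewrite -{1}[v]natr_Zp unit_prime_squareE.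
  by move: ip; clear; lia.
exists i => // x xb; have xbd := beta_bounds p_prime i_bd xb.
have xm : x < p ^ 2 by move: xbd m1; clear; lia.
suff : (0 < a x%:R - a (- x%:R))%R by move/al_gt0; rewrite val_Zp_nat// modn_small.
move: xb; rewrite mem_beta => /orP[/eqP->|/mapP[j _ ->]].
  have -> : ((p * (p - i))%:R = - (p%:R * v) :> 'Z_(p ^ 2))%R.
    apply/eqP; rewrite -addr_eq0 -{1}[v]natr_Zp -natrM -natrD vE.
    have pE q c : c <= p -> p * (p - c) + p * (q * p + c) = p ^ 2 * q.+1.
      move=> cp; rewrite -mulnDr addnCA subnK// -mulSnr [_ * p]mulnC mulnA.
      by rewrite expnS expn1.
    rewrite pE; last by rewrite ltnW// ltn_mod.
    by rewrite natrM natr_modulus// mul0r.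
  have [k k0] := sawtooth_relation_multiple p_prime p_odd aE uv.
  by rewrite opprK mulNr => h; rewrite -(opprB (a (p%:R * v)%R)) h opprK mulr_gt0//.
have -> : ((i + j * p)%:R = v + p%:R * (j%:R - ((v : nat) %/ p)%:R) :> 'Z_(p ^ 2))%R.
  rewrite -{1}[v]natr_Zp {1}vE !natrD !natrM; ring.
by have -> := sawtooth_relation_periodic p_prime p_odd aE
  (j%:R - ((v : nat) %/ p)%:R)%R uv.
Qed.

(** Some [x] in [b] has [p ^ 2 - x] outside [b], so the difference is positive at [x]. If [x = p y],
    it is negative at the unit [y], and [- y] is used. *)
Lemma exceptional_contains_beta : exceptional (p ^ 2) b ->
  exists2 i, 1 <= i <= p - 1 & {subset beta p i <= b}.
Proof.
have [szb [/allP bd bs] _ _] := bB.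
have ub : uniq b by apply: sorted_uniq bs; [exact: ltn_trans|exact: ltnn].
have [/hasP[x xb xN]|/hasPn sym] := boolP (has (fun x => p ^ 2 - x \notin b) b);
  last first.
  move=> exc; exfalso; apply: (@symmetric_not_exceptional (p ^ 2) b) exc => //.
  - by rewrite oddX p_odd.
  - by move=> x /sym; rewrite negbK.
move=> _; have xbd := bd x xb.
have xm : x < p ^ 2 by move: xbd m1; clear; lia.
have xZ : nat_of_ord (x%:R : 'Z_(p ^ 2))%R = x by rewrite val_Zp_nat// modn_small.
have alx : (0 < a x%:R - a (- x%:R))%R.
  have -> : (- x%:R = (p ^ 2 - x)%:R :> 'Z_(p ^ 2))%R.
    by rewrite natrB ?(ltnW xm)// natr_modulus// sub0r.
  rewrite /a xZ xb val_Zp_nat// modn_small ?(negbTE xN) ?subr0 ?ltr01//.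
  by move: xbd; clear; lia.
have [ux|nux] := boolP ((x%:R : 'Z_(p ^ 2)) \is a GRing.unit)%R.
  exact: beta_sub_of_unit alx.
have /dvdnP[y xy] : p %| x by move: nux; rewrite unit_prime_squareE// negbK.
have uy : ((y%:R : 'Z_(p ^ 2)) \is a GRing.unit)%R.
  rewrite unit_prime_squareE//; apply/negP => /dvdnP[z yz].
  have : p ^ 2 %| x by rewrite xy yz -mulnA expnS expn1 dvdn_mull.
  by move=> /dvdn_leq; move: xbd xm; clear; lia.
have [k k0 h] := sawtooth_relation_multiple p_prime p_odd aE uy.
apply: (@beta_sub_of_unit (- y%:R)%R); first by rewrite unitrN.
move: alx; rewrite xy mulnC natrM h mulNr oppr_gt0 pmulr_rlt0// opprK.
by rewrite subr_lt0 subr_gt0.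
Qed.

End Classification.

(** The [beta p i] inside [b] has even size and sum divisible by [p ^ 2], so it cannot be proper;
    its size gives [d]. *)
Lemma indecomposable_is_beta (p d : nat) (b : seq nat) : prime p -> odd p ->
  indecomposable (p ^ 2) d b ->
  d = (p + 1) %/ 2 /\ exists2 i, 1 <= i <= p - 1 & b = beta p i.
Proof.
move=> p_prime p_odd [bB bexc bind].
have [i i_bd sub] := exceptional_contains_beta p_prime p_odd bB bexc.
have [szb [/allP bd bs] _ _] := bB.
have sb := subseq_of_sorted (beta_sorted p_prime i_bd) bs sub.
have bE : beta p i = b.
  apply/eqP/negPn/negP => /eqP nb.
  have := bind _ sb _ nb; rewrite size_beta addn1 /= p_odd sum_beta//.
  rewrite dvdn_mulr// => /(_ _ isT) h; apply: notF; apply: h.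
  by move=> /(congr1 size); rewrite size_beta addn1.
split; last by exists i.
by move: szb; rewrite -bE size_beta => ->; rewrite mulKn.
Qed.

(** Every unit dilate of [beta p i] is some [beta p r], and all of these have the same sum. *)
Lemma beta_inB (p i : nat) : prime p -> odd p -> 1 <= i <= p - 1 ->
  inB (p ^ 2) ((p + 1) %/ 2) (beta p i).
Proof.
move=> p_prime p_odd i_bd; have m1 := prime_square_gt1 p_prime.
split.
- by rewrite size_beta; move: p_odd; rewrite -{1}[p]odd_double_half; lia.
- split; last exact: beta_sorted.
  by apply/allP => x /(beta_bounds p_prime i_bd).
- by rewrite sum_beta// modnMr mod0n.
- move=> t ut; have [r r_bd rperm] := beta_dilate p_prime i_bd ut.
  rewrite /weight -mulr_suml -(big_map (fun x => nat_of_ord (t * x%:R)%R) xpredT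
    (fun x => x%:R : rat)%R) (perm_big _ rperm)/= -natr_sum sum_beta// natrM.
  by rewrite mulrC mulKf// pnatr_eq0; lia.
Qed.

Theorem theorem3p21 (p : nat) (p_prime : prime p) (p_odd : odd p) :
  [/\ forall b : seq nat,
        indecomposable (p ^ 2) ((p + 1) %/ 2) b <->
        exists2 i : nat, 1 <= i <= p - 1 & b = beta p i,
      forall i j : nat, 1 <= i <= p - 1 -> 1 <= j <= p - 1 ->
        beta p i = beta p j -> i = j
    & forall d' : nat, 1 <= d' <= (p ^ 2 - 1) %/ 2 -> d' <> (p + 1) %/ 2 ->
        ~ exists b : seq nat, indecomposable (p ^ 2) d' b].
Proof.
split.
- move=> b; split=> [|[i i_bd ->]].
    by move=> /(indecomposable_is_beta p_prime p_odd)[].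
  split; [exact: beta_inB|exact: beta_exceptional|].
  move=> s sb s0 sbeta seven; apply: contra (subseq_beta_sum p_prime p_odd i_bd sb s0 sbeta seven).
  by apply: dvdn_trans; rewrite expnS dvdn_mulr.
- move=> i j i_bd j_bd ij.
  (* The index is recovered as the residue modulo [p] of any entry prime to [p]; [i] itself is
     one. *)
  have ib : i \in beta p j.
    rewrite -ij; apply: (mem_beta_of_mod p_prime); last by rewrite modn_small//; lia.
    by rewrite expnS expn1; nia.
  have := mem_beta_mod p_prime j_bd ib.
  by rewrite gtnNdvd ?modn_small//; lia.
- move=> d' _ dn [b]; move=> /(indecomposable_is_beta p_prime p_odd)[dE _].
  exact: dn.
Qed.
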